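(* Let $n\geq 1$ and let $\rho:hP_n\to\mathrm{Aut}(RF_n)$ be the homotopy Artin action. Then the Andreadakis equality holds for $hP_n$: for every $j\geq1$, an element of $hP_n$ lies in $\Gamma_j(hP_n)$ if and only if its image under $\rho$ lies in $\mathcal A_j(RF_n)$, i.e. $\Gamma_j(hP_n)=\rho^{-1}(\mathcal A_j(RF_n))$.
   Context: Notation: $x^y=y^{-1}xy$, $[x,y]=xyx^{-1}y^{-1}$, $\Gamma_*$ is the lower central series. $RF_n=\langle x_1,\dots,x_n\mid [x_i,x_i^w]=1\ (w\in F_n)\rangle$ is the reduced free group. $P_n$ is the pure braid group on $n$ strands, with standard generators $A_{ij}$; $hP_n$ is the group of pure braids up to link-homotopy, equivalently the quotient of $P_n$ by the relations saying that, for $j<k$, $A_{jk}$ commutes with all its conjugates by elements of $\langle A_{ik}\rangle_{i<k}$. The Artin action $P_n\to\mathrm{Aut}(F_n)$ descends to a morphism $\rho:hP_n\to\mathrm{Aut}(RF_n)$, the homotopy Artin action; equivalently it is the conjugation action in the semi-direct product decomposition $hP_{n+1}\cong RF_n\rtimes hP_n$ (where $RF_n$ is generated by the $A_{i,n+1}$). The Andreadakis filtration is $\mathcal A_j(RF_n)=\{\sigma\in\mathrm{Aut}(RF_n):\sigma(g)g^{-1}\in\Gamma_{i+j}(RF_n)\ \forall i\geq1,\ \forall g\in\Gamma_i(RF_n)\}$. *)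

(* Defs.v *)
From mathcomp Require Import all_boot.
Set Implicit Arguments. Unset Strict Implicit. Unset Printing Implicit Defensive.

(** * Words in a free group over generators of type T.
    A letter (a, false) is the generator a, (a, true) is a^-1. *)
Definition word (T : Type) := seq (T * bool).

Definition inv_word {T : Type} (w : word T) : word T :=
  rev (map (fun a => (a.1, ~~ a.2)) w).
Definition gen {T : Type} (a : T) : word T := [:: (a, false)].
Definition comm_word {T : Type} (u v : word T) : word T :=
  u ++ v ++ inv_word u ++ inv_word v.
Definition conj_word {T : Type} (u w : word T) : word T :=
  inv_word w ++ u ++ w.

Inductive pres_eq {T : Type} (R : word T -> Prop) : word T -> word T -> Prop :=
| pe_refl w : pres_eq R w w
| pe_sym u v : pres_eq R u v -> pres_eq R v u
| pe_trans u v w : pres_eq R u v -> pres_eq R v w -> pres_eq R u w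
| pe_cancel u v a b : pres_eq R (u ++ (a, b) :: (a, ~~ b) :: v) (u ++ v)
| pe_rel u v r : R r -> pres_eq R (u ++ r ++ v) (u ++ v).

Inductive subgrp {T : Type} (R : word T -> Prop) (P : word T -> Prop) : word T -> Prop :=
| sg_base w : P w -> subgrp R P w
| sg_one : subgrp R P [::]
| sg_inv w : subgrp R P w -> subgrp R P (inv_word w)
| sg_mul u v : subgrp R P u -> subgrp R P v -> subgrp R P (u ++ v)
| sg_eq u v : pres_eq R u v -> subgrp R P u -> subgrp R P v.

(** Lower central series: Gamma_1 = G, Gamma_{k+1} = [Gamma_k, G].
    (Gamma_0 is also set to G by convention; it is never used.) *)
Fixpoint lcs {T : Type} (R : word T -> Prop) (k : nat) : word T -> Prop :=
  match k with
  | 0 => fun _ => True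
  | k'.+1 =>
      match k' with
      | 0 => fun _ => True
      | _ => subgrp R (fun c => exists g h, lcs R k' g /\ c = comm_word g h)
      end
  end.

Definition RF_rel (n : nat) (w : word 'I_n) : Prop :=
  exists (i : 'I_n) (u : word 'I_n), w = comm_word (gen i) (conj_word (gen i) u).

(** * Artin action.  For r < s, phi_rs is the automorphism of F_n given by
    conjugation by A_rs in F_n ⋊ P_n (x^{A_rs} = A_rs^-1 x A_rs):
      x_r |-> (x_r x_s) x_r (x_r x_s)^-1,  x_s |-> x_r x_s x_r^-1,
      x_k |-> [x_r,x_s] x_k [x_r,x_s]^-1  for r < k < s,
      x_k |-> x_k  otherwise.
    [artin_img x r s k] is phi_rs(x_k), with generators renamed through x. *)
Definition artin_img {n : nat} {T : Type} (x : 'I_n -> T) (r s k : 'I_n) : word T :=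
  let X i := (x i, false) in
  let Xi i := (x i, true) in
  if k == r then [:: X r; X s; X r; Xi s; Xi r]
  else if k == s then [:: X r; X s; Xi r]
  else if (r < k) && (k < s) then [:: X r; X s; Xi r; Xi s; X k; X s; X r; Xi s; Xi r]
  else [:: X k].

Definition artin_img_inv {n : nat} {T : Type} (x : 'I_n -> T) (r s k : 'I_n) : word T :=
  let X i := (x i, false) in
  let Xi i := (x i, true) in
  if k == r then [:: Xi s; X r; X s]
  else if k == s then [:: Xi s; Xi r; X s; X r; X s]
  else if (r < k) && (k < s) then [:: Xi s; Xi r; X s; X r; X k; Xi r; Xi s; X r; X s]
  else [:: X k].

Definition subst_word {T U : Type} (f : T -> word U) (w : word T) : word U :=
  flatten (map (fun a => if a.2 then inv_word (f a.1) else f a.1) w).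

(** * Pure braid groups.  Generators A_ij are indexed by pairs (i, j) : 'I_n * 'I_n;
    the pairs with ~ (i < j) are killed by relators (they are not generators).
    Relators of P_n (Artin's presentation, from P_j = F_{j-1} ⋊ P_{j-1}):
      A_rs^-1 A_ij A_rs = phi_rs(x_i)[x_m := A_mj]   for r < s < j, i < j. *)
Definition P_rel (n : nat) (w : word ('I_n * 'I_n)) : Prop :=
  (exists i j : 'I_n, ~~ (i < j) /\ w = gen (i, j))
  \/ (exists r s i j : 'I_n, [/\ r < s, s < j, i < j &
        w = conj_word (gen (i, j)) (gen (r, s))
            ++ inv_word (artin_img (fun m => (m, j)) r s i)]).

Definition hP_rel (n : nat) (w : word ('I_n * 'I_n)) : Prop :=
  P_rel w
  \/ (exists j k : 'I_n, j < k /\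
        exists u : word ('I_n * 'I_n),
          all (fun a : ('I_n * 'I_n) * bool => (a.1.2 == k) && (a.1.1 < k)) u /\
          w = comm_word (gen (j, k)) (conj_word (gen (j, k)) u)).

(** The homotopy Artin action rho of a (representative word of an) element of hP_n
    on (representative words of) elements of RF_n.  It is a right action:
    the letters of beta are applied from left to right, x^(ab) = (x^a)^b. *)
Definition artin_letter {n : nat} (a : ('I_n * 'I_n) * bool) (g : word 'I_n) : word 'I_n :=
  let r := a.1.1 in let s := a.1.2 in
  if r < s then
    subst_word (if a.2 then artin_img_inv id r s else artin_img id r s) g
  else g.

Definition rho {n : nat} (beta : word ('I_n * 'I_n)) (g : word 'I_n) : word 'I_n :=
  foldl (fun h a => artin_letter a h) g beta.

Definition Gamma_hP (n j : nat) : word ('I_n * 'I_n) -> Prop := lcs (@hP_rel n) j.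
Definition Gamma_RF (n j : nat) : word 'I_n -> Prop := lcs (@RF_rel n) j.

Definition in_Andreadakis (n j : nat) (beta : word ('I_n * 'I_n)) : Prop :=
  forall (i : nat) (g : word 'I_n), 1 <= i -> @Gamma_RF n i g ->
    @Gamma_RF n (i + j) (rho beta g ++ inv_word g).

(* Main.v *)
(* The group hP_n is combed: every element is v u with u a word in the A_ik, i < k, and v a
   braid on the first k strands.  Acting on the generator x_k of RF_n, the factor v is trivial
   and u is conjugation by the word w obtained from u by A_ik |-> x_i.  If the braid lies in
   the j-th step of the Andreadakis filtration, then [w, x_k] is in Gamma_(j+1)(RF_n); since w
   does not involve x_k, its Magnus expansion has no term of degree between 1 and j - 1, so w
   is in Gamma_j(RF_n) and u, its image under x_i |-> A_ik, is in Gamma_j(hP_n).  The easy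
   inclusion of Gamma_j(hP_n) into the filtration lets one cancel u and induct on k. *)
Require Import Defs.
From HB Require Import structures.
From mathcomp Require Import all_boot all_algebra.
From mathcomp Require Import generic_quotient boolp.
From mathcomp Require Import ring.
Set Implicit Arguments. Unset Strict Implicit. Unset Printing Implicit Defensive.
Local Open Scope group_scope.

(** * Groups and their lower central series *)

(** Since the statement is about words, the fact that [rho] factors through hP_n has to be proved;
    it is what allows a braid to be replaced by its combed form and a factor to be cancelled. The
    pure braid relators reduce to a finite computation. The homotopy relators are harder: A_jk must
    commute with its conjugates as an automorphism of RF_n, which is seen inside the abelian normal
    closures of x_j and x_k, up to errors in their mutual commutator subgroup. The passage from a
    Magnus expansion back to Gamma_j(RF_n) is a dimension subgroup theorem. It holds because the
    relations [x_i, x_i^w] = 1 both force the truncation at repeated letters and make the normal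
    closure of x_m abelian, so that the coefficients on monomials ending in X_m serve as exponents
    of commutators ending in x_m. *)

(** Serves twice, for words modulo a presentation and for a group modulo Gamma_k. The congruence is
    any proposition, made boolean classically. *)
Lemma congruence_quotient (T : choiceType) (mul : T -> T -> T) (one : T)
    (inv : T -> T) (E : T -> T -> Prop) :
    (forall x, E x x) -> (forall x y, E x y -> E y x) ->
    (forall x y z, E x y -> E y z -> E x z) ->
    (forall x x' y y', E x x' -> E y y' -> E (mul x y) (mul x' y')) ->
    (forall x x', E x x' -> E (inv x) (inv x')) ->
    (forall x y z, E (mul x (mul y z)) (mul (mul x y) z)) ->
    (forall x, E (mul one x) x) -> (forall x, E (mul x one) x) ->
    (forall x, E (mul (inv x) x) one) -> (forall x, E (mul x (inv x)) one) ->
  exists (G : groupType) (p : T -> G),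
    [/\ forall x y, p (mul x y) = p x * p y,
        forall x y, p x = p y <-> E x y & forall g, exists x, p x = g].
Proof.
move=> Er Es Et Em Ei mA m1l m1r mVl mVr.
pose e x y := `[< E x y >].
have er : reflexive e by move=> x; apply/asboolP.
have es : symmetric e by move=> x y; apply/asboolP/asboolP; apply: Es.
have et : transitive e.
  by move=> y x z /asboolP h1 /asboolP h2; apply/asboolP; apply: Et h1 h2.
pose eR := EquivRel e er es et.
pose Q : choiceType := {eq_quot eR}%qT.
pose pi (x : T) : Q := (\pi_({eq_quot eR}) x)%qT.
have piE x y : pi x = pi y <-> E x y.
  have h : reflect (pi x = pi y) (eR x y) by exact: (eqmodP eR x y).
  by split=> [/h/asboolP|/asboolP/h].
have reprE x : E (repr (pi x)) x by apply/piE; rewrite /pi reprK.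
have piK (g : Q) : pi (repr g) = g by rewrite /pi reprK.
pose gm (g h : Q) : Q := pi (mul (repr g) (repr h)).
pose gi (g : Q) : Q := pi (inv (repr g)).
have gmE x y : gm (pi x) (pi y) = pi (mul x y) by apply/piE/Em; apply: reprE.
have giE x : gi (pi x) = pi (inv x) by apply/piE/Ei; apply: reprE.
have gA : associative gm.
  by move=> x y z; rewrite -(piK x) -(piK y) -(piK z) !gmE; apply/piE.
have g1l : left_id (pi one) gm by move=> x; rewrite -(piK x) gmE; apply/piE.
have g1r : right_id (pi one) gm by move=> x; rewrite -(piK x) gmE; apply/piE.
have gVl : left_inverse (pi one) gi gm.
  by move=> x; rewrite -(piK x) giE gmE; apply/piE.
have gVr : right_inverse (pi one) gi gm.
  by move=> x; rewrite -(piK x) giE gmE; apply/piE.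
exists (HB.pack_for groupType Q (isGroup.Build Q gA g1l g1r gVl gVr)), pi.
by split=> // g; exists (repr g); rewrite piK.
Qed.

(* Normalises group words, hence decides identities of free groups. *)
Ltac gsimp :=
  rewrite ?(invgM, invgK, invg1, mulgA, mulgK, mulgVK, mulgV, mulVg, mul1g, mulg1).

Section Group.
Variable G : groupType.
Implicit Types (x y g h : G) (P : G -> Prop).

(* The conventions of the paper; MathComp's [~ x, y] is x^-1 * y^-1 * x * y. *)
Definition cm x y := x * y * x^-1 * y^-1.
Definition cj x y := x * y * x^-1.

Inductive generated P : G -> Prop :=
| generated_base x : P x -> generated P x
| generated1 : generated P 1
| generatedV x : generated P x -> generated P x^-1
| generatedM x y : generated P x -> generated P y -> generated P (x * y).

Fixpoint lcsg (k : nat) : G -> Prop :=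
  match k with
  | 0 => fun _ => True
  | k'.+1 =>
      match k' with
      | 0 => fun _ => True
      | _ => generated (fun c => exists g h, lcsg k' g /\ c = cm g h)
      end
  end.

Lemma lcsg_1 k : lcsg k 1.
Proof. by case: k => [|[|k]] //; apply: generated1. Qed.

Lemma lcsgV k x : lcsg k x -> lcsg k x^-1.
Proof. by case: k => [|[|k]] //; apply: generatedV. Qed.

Lemma lcsgM k x y : lcsg k x -> lcsg k y -> lcsg k (x * y).
Proof. by case: k => [|[|k]] //; apply: generatedM. Qed.

Lemma lcsg_cm k x y : lcsg k x -> lcsg k.+1 (cm x y).
Proof. by case: k => [|k] // hx; apply: generated_base; exists x, y. Qed.

Lemma lcsgVE k x : lcsg k x^-1 <-> lcsg k x.
Proof. by split=> /lcsgV //; rewrite invgK. Qed.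

End Group.

Section Morph.
Variables (G H : groupType) (f : G -> H).
Hypothesis fM : {morph f : x y / x * y}.

Lemma mor1 : f 1 = 1.
Proof. by apply: (mulgI (f 1)); rewrite -fM !mulg1. Qed.

Lemma morV : {morph f : x / x^-1}.
Proof. by move=> x; apply: (mulgI (f x)); rewrite -fM !mulgV mor1. Qed.

Lemma mor_cm x y : f (cm x y) = cm (f x) (f y).
Proof. by rewrite /cm !fM !morV. Qed.

Lemma mor_cj x y : f (cj x y) = cj (f x) (f y).
Proof. by rewrite /cj !fM !morV. Qed.

Lemma generated_mor (P : G -> Prop) (P' : H -> Prop) :
  (forall x, P x -> generated P' (f x)) -> forall x, generated P x -> generated P' (f x).
Proof.
move=> h x; elim=> {x} [x /h|||] //; rewrite ?mor1; first exact: generated1.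
- by move=> x _ IH; rewrite morV; apply: generatedV.
- by move=> x y _ IH _ IH'; rewrite fM; apply: generatedM.
Qed.

Lemma lcsg_mor k x : lcsg k x -> lcsg k (f x).
Proof.
elim: k x => [|[|k] IH] //.
apply: generated_mor => x [g [h [hg ->]]]; rewrite mor_cm.
by apply: (@lcsg_cm H k.+1); apply: IH.
Qed.

End Morph.

Section Group2.
Variable G : groupType.
Implicit Types (x y g h : G) (P : G -> Prop).

Lemma cj_mor x : {morph cj x : y z / y * z}.
Proof. by move=> y z; rewrite /cj; gsimp. Qed.

Lemma cjM x y z : cj (x * y) z = cj x (cj y z).
Proof. by rewrite /cj; gsimp. Qed.

Lemma cj1 x : cj 1 x = x. Proof. by rewrite /cj; gsimp. Qed.

Lemma cm_eq1 x y : cm x y = 1 <-> commute x y.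
Proof.
split=> [h|h]; last by rewrite /cm h; gsimp.
by apply: (divg1_eq (x := x * y)); rewrite invgM mulgA.
Qed.

(** Core of three later arguments, where a map multiplies g by a and h by b and [g, h] must not
    change. As a commutes with everything in sight it drops out; b then passes over g and over h
    g^-1 h^-1 to meet b^-1, so it need not commute with h. *)
Lemma cm_absorb a b g h : commute a g -> commute a b -> commute a h -> commute b g ->
  commute b (cj h g^-1) -> cm (a * g) (b * h) = cm g h.
Proof.
move=> h1 h2 h3 hg hgh.
have ac : commute a (g * b * h * g^-1).
  by apply: commuteM; [do 2?apply: commuteM | apply: commuteV].
have -> : cm (a * g) (b * h) = a * (g * b * h * g^-1) * a^-1 * h^-1 * b^-1.
  by rewrite /cm; gsimp.
rewrite ac mulgK -hg.
have -> : b * g * h * g^-1 * h^-1 * b^-1 = b * g * (cj h g^-1 * b^-1) by rewrite /cj; gsimp.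
have -> : cj h g^-1 * b^-1 = b^-1 * cj h g^-1 by apply/commute_sym/commute_sym/commuteV/commute_sym.
by rewrite hg /cj /cm; gsimp.
Qed.

End Group2.

Section Group3.
Variable G : groupType.
Implicit Types (x y g h : G) (P : G -> Prop).

Lemma lcsg_cj k x y : lcsg k y -> lcsg k (cj x y).
Proof. exact: (lcsg_mor (cj_mor x)). Qed.

Lemma lcsgS k x : lcsg k.+1 x -> lcsg k x.
Proof.
case: k => [|k] //; elim=> {x} [x [g [h [hg ->]]]|||].
- rewrite /cm -mulgA -mulgA; apply: lcsgM => //; rewrite mulgA.
  by apply: lcsg_cj; apply: lcsgV.
- exact: lcsg_1.
- by move=> x _; apply: lcsgV.
- by move=> x y _ hx _; apply: lcsgM.
Qed.

Lemma lcsg_le i j x : i <= j -> lcsg j x -> lcsg i x.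
Proof. by move=> /subnK <-; elim: (j - i)%N => // k IH /lcsgS. Qed.

(** Turns congruences modulo Gamma_k into equations, and membership of a commutator in Gamma_k into
    commutation. *)
Lemma lcsg_quotient k : exists (Q : groupType) (q : G -> Q),
  {morph q : x y / x * y} /\ forall x, q x = 1 <-> lcsg k x.
Proof.
have [|||||||||| Q [q [qM qE _]]] := @congruence_quotient G *%g 1
  (fun x => x^-1) (fun x y => lcsg k (x * y^-1)).
- by move=> x; rewrite mulgV; apply: lcsg_1.
- by move=> x y h; rewrite -lcsgVE; gsimp.
- by move=> x y z h1 h2; move: (lcsgM h1 h2); gsimp.
- move=> x x' y y' h1 h2; move: (lcsgM (lcsg_cj x h2) h1); rewrite /cj.
  by gsimp.
- move=> x x' h; have := lcsg_cj x^-1 (lcsgV h).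
  by rewrite /cj; gsimp.
- by move=> x y z; gsimp; apply: lcsg_1.
- by move=> x; gsimp; apply: lcsg_1.
- by move=> x; gsimp; apply: lcsg_1.
- by move=> x; gsimp; apply: lcsg_1.
- by move=> x; gsimp; apply: lcsg_1.
exists Q, q; split=> // x.
by rewrite -[X in _ = X](mor1 qM) qE; gsimp.
Qed.

(* Modulo Gamma_(i+j), conjugating [g, h] by x multiplies g by a central element and h by
   one which commutes with g and h g^-1 h^-1. *)
Lemma lcsg_cmm i j x y : lcsg i x -> lcsg j y -> 0 < j -> lcsg (i + j) (cm x y).
Proof.
elim: j i x y => [|[|j] IH] i x y hx hy // _.
  by rewrite addn1; apply: lcsg_cm.
have [Q [q [qM qE]]] := lcsg_quotient (i + j.+2).
rewrite -qE (mor_cm qM) cm_eq1.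
elim: y / hy => [y [g [h [hg ->]]]|||].
- have {}hg : lcsg j.+1 g by []; pose a := cm x g; pose b := cm x h.
  have qa z : commute (q a) (q z).
    apply/cm_eq1; rewrite -(mor_cm qM) qE addnS; apply: lcsg_cm.
    exact: IH.
  have qb z : lcsg j.+1 z -> commute (q b) (q z).
    move=> hz; apply/cm_eq1; rewrite -(mor_cm qM) qE addnS -addSn; apply: IH => //.
    exact: lcsg_cm.
  have e1 : cj x g = a * g by rewrite /a /cj /cm; gsimp.
  have e2 : cj x h = b * h by rewrite /b /cj /cm; gsimp.
  clearbody a b.
  have e : q (cj x (cm g h)) = q (cm g h).
    rewrite (mor_cm (cj_mor x)) e1 e2 !(mor_cm qM) !qM; apply: cm_absorb.
    - exact: qa.
    - exact: qa.
    - exact: qa.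
    - exact: qb.
    by have := qb _ (lcsg_cj h (lcsgV hg)); rewrite (mor_cj qM) (morV qM).
  by apply/cm_eq1; have -> : cm (q x) (q (cm g h)) = q (cj x (cm g h)) * (q (cm g h))^-1;
    [by rewrite (mor_cj qM) | rewrite e mulgV].
- by rewrite (mor1 qM); apply: commute1.
- move=> y' _ h; rewrite (morV qM); exact: commuteV.
- by move=> y1 y2 _ h1 _ h2; rewrite qM; apply: commuteM.
Qed.

End Group3.

(** * Groups given by presentations *)

Section Words.
Variable T : Type.
Implicit Types (u v w : word T) (R : word T -> Prop).

Lemma inv_word_cat u v : inv_word (u ++ v) = inv_word v ++ inv_word u.
Proof. by rewrite /inv_word map_cat rev_cat. Qed.

Lemma inv_word_cons a b u : inv_word ((a, b) :: u) = inv_word u ++ [:: (a, ~~ b)].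
Proof. by rewrite -cat1s inv_word_cat. Qed.

Lemma inv_wordK u : inv_word (inv_word u) = u.
Proof.
rewrite /inv_word map_rev revK -map_comp -[RHS]map_id.
by apply: eq_map => -[a b] /=; rewrite negbK.
Qed.

Lemma pe_ctx R a b u v : pres_eq R u v -> pres_eq R (a ++ u ++ b) (a ++ v ++ b).
Proof.
elim=> {u v} [w|u v _ IH|u v w _ IH1 _ IH2|u v c d|u v r hr].
- exact: pe_refl.
- exact: pe_sym.
- exact: pe_trans IH1 IH2.
- by have := pe_cancel R (a ++ u) (v ++ b) c d; rewrite -!catA.
- by have := pe_rel (a ++ u) (v ++ b) hr; rewrite -!catA.
Qed.

Lemma pe_cat R u u' v v' :
  pres_eq R u u' -> pres_eq R v v' -> pres_eq R (u ++ v) (u' ++ v').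
Proof.
move=> hu hv; apply: (pe_trans (v := u' ++ v)).
  by have := pe_ctx [::] v hu.
by have := pe_ctx u' [::] hv; rewrite !cats0.
Qed.

Lemma pe_invr R u : pres_eq R (u ++ inv_word u) [::].
Proof.
elim: u => [|[a b] u IH]; first exact: pe_refl.
rewrite inv_word_cons -cat1s -!catA.
apply: pe_trans (pe_cancel R [::] [::] a b).
by have := pe_ctx [:: (a, b)] [:: (a, ~~ b)] IH; rewrite -!catA.
Qed.

Lemma pe_invl R u : pres_eq R (inv_word u ++ u) [::].
Proof. by rewrite -{2}(inv_wordK u); apply: pe_invr. Qed.

Lemma pe_inv R u v : pres_eq R u v -> pres_eq R (inv_word u) (inv_word v).
Proof.
move=> h; apply: (pe_trans (v := inv_word u ++ v ++ inv_word v)).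
  rewrite -{1}(cats0 (inv_word u)); apply: pe_cat (pe_refl _ _) _.
  exact/pe_sym/pe_invr.
rewrite catA -{2}(cat0s (inv_word v)); apply: pe_cat (pe_refl _ _).
apply: pe_trans (pe_invl R u); apply: pe_cat (pe_refl _ _) _; exact: pe_sym.
Qed.

Definition ev (G : groupType) (f : T -> G) (w : word T) : G :=
  foldr (fun a x => (if a.2 then (f a.1)^-1 else f a.1) * x) 1 w.

Section Ev.
Variables (G : groupType) (f : T -> G).

Lemma ev_cat u v : ev f (u ++ v) = ev f u * ev f v.
Proof. by elim: u => [|a u IH] /=; rewrite ?mul1g // IH mulgA. Qed.

Lemma ev_inv u : ev f (inv_word u) = (ev f u)^-1.
Proof.
elim: u => [|[a b] u IH] /=; first by rewrite invg1.
rewrite inv_word_cons ev_cat IH /= mulg1 invgM.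
by case: b => //=; rewrite invgK.
Qed.

Lemma ev_gen a : ev f (gen a) = f a. Proof. exact: mulg1. Qed.

Lemma ev_comm u v : ev f (comm_word u v) = cm (ev f u) (ev f v).
Proof. by rewrite /comm_word !ev_cat !ev_inv /cm !mulgA. Qed.

Lemma ev_conj u v : ev f (conj_word u v) = cj (ev f v)^-1 (ev f u).
Proof. by rewrite /conj_word !ev_cat !ev_inv /cj invgK !mulgA. Qed.

Lemma ev_pres R : (forall r, R r -> ev f r = 1) ->
  forall u v, pres_eq R u v -> ev f u = ev f v.
Proof.
move=> hR u v; elim=> {u v} [|u v _ ->|u v w _ -> _ ->|u v a b|u v r /hR hr] //.
- by rewrite !ev_cat /=; case: b => /=; gsimp.
- by rewrite !ev_cat hr mul1g.
Qed.

End Ev.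

End Words.

Lemma ev_subst T U (G : groupType) (f : U -> G) (h : T -> word U) w :
  ev f (subst_word h w) = ev (fun a => ev f (h a)) w.
Proof.
elim: w => [|[a b] w IH] //; rewrite /subst_word /= ev_cat -/(subst_word h w) IH.
by case: b => //=; rewrite ev_inv.
Qed.

Lemma ev_mor T (G H : groupType) (k : G -> H) (f : T -> G) w :
  {morph k : x y / x * y} -> k (ev f w) = ev (fun a => k (f a)) w.
Proof.
move=> kM; elim: w => [|[a b] w IH] /=; first exact: mor1.
by rewrite kM IH; case: b => //=; rewrite (morV kM).
Qed.

Lemma eq_ev T (G : groupType) (f g : T -> G) : f =1 g -> ev f =1 ev g.
Proof. by move=> fg; elim=> [|[a b] w IH] //=; rewrite fg IH. Qed.

(** Keeps only what moves statements between words and elements: when two words have the same value,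
    and that values exhaust the group. *)
Record presents (T : choiceType) (R : word T -> Prop) (G : groupType) (f : T -> G) := {
  pres_evP : forall u v, ev f u = ev f v <-> pres_eq R u v;
  pres_surj : forall g, exists w, ev f w = g }.

Section Presented.
Variables (T : choiceType) (R : word T -> Prop).

Lemma presentation : exists (G : groupType) (f : T -> G), presents R f.
Proof.
have [|||||||||| G [p [pM pE pS]]] :=
  @congruence_quotient (word T : choiceType) cat [::] inv_word (pres_eq R).
- exact: pe_refl.
- exact: pe_sym.
- exact: pe_trans.
- exact: pe_cat.
- exact: pe_inv.
- by move=> x y z; rewrite catA; apply: pe_refl.
- exact: pe_refl.
- by move=> x; rewrite cats0; apply: pe_refl.
- exact: pe_invl.
- exact: pe_invr.
exists G, (fun a => p (gen a)).
have p1 : p [::] = 1 by apply: (mulgI (p [::])); rewrite -pM mulg1.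
have evp w : ev (fun a => p (gen a)) w = p w.
  elim: w => [|[a b] w IH] /=; first by rewrite p1.
  rewrite IH -cat1s pM; congr (_ * _); case: b => //.
  apply/mulg1_eq; rewrite -pM -p1; apply/pE.
  exact: (pe_cancel R [::] [::] a false).
by split=> [u v|g]; rewrite ?evp //; have [w <-] := pS g; exists w.
Qed.

Variables (G : groupType) (f : T -> G).
Hypothesis fR : presents R f.

Lemma pres_rel r : R r -> ev f r = 1.
Proof.
by move=> hr; apply/(pres_evP fR r [::]); have := pe_rel [::] [::] hr; rewrite /= cats0.
Qed.

Lemma pres_lift (H : groupType) (h : T -> H) : (forall r, R r -> ev h r = 1) ->
  exists2 k : G -> H, {morph k : x y / x * y} & forall w, k (ev f w) = ev h w.
Proof.
move=> hR; have [s hs] := choice (pres_surj fR).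
have kE w : ev h (s (ev f w)) = ev h w.
  by apply: (ev_pres hR); apply/(pres_evP fR); rewrite hs.
exists (fun g => ev h (s g)) => // x y.
by rewrite -(hs x) -(hs y) -ev_cat !kE ev_cat.
Qed.

Lemma lcs_lcsg k w : lcs R k w <-> lcsg k (ev f w).
Proof.
elim: k w => [|[|k] IH] w //; split.
- elim=> {w} [w [g [h [/IH hg ->]]]||w _|u v _ IHu _ IHv|u v /(pres_evP fR) <-] //.
  + by rewrite ev_comm; apply: (@lcsg_cm G k.+1).
  + exact: generated1.
  + by move=> h; rewrite ev_inv; apply: generatedV.
  + by rewrite ev_cat; apply: generatedM.
(* The value of [w] is generalized so that the induction runs on the group element, for every word
   representing it. *)
- move: {-2}(ev f w) (erefl (ev f w)) => x ex hx.
  elim: hx w ex => {x} [x [g [h [hg ->]]] w|w|x _ IHx w|x y _ IHx _ IHy w] ew.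
  + have [u eu] := pres_surj fR g; have [v ev'] := pres_surj fR h.
    apply: (sg_eq (u := comm_word u v)).
      by apply/(pres_evP fR); rewrite -ew ev_comm eu ev'.
    by apply: sg_base; exists u, v; split=> //; apply/IH; rewrite eu.
  + by apply: (sg_eq (u := [::])); [apply/(pres_evP fR); rewrite -ew|apply: sg_one].
  + have [u eu] := pres_surj fR x.
    apply: (sg_eq (u := inv_word u)); last by apply/sg_inv/IHx.
    by apply/(pres_evP fR); rewrite ev_inv eu -ew.
  + have [u eu] := pres_surj fR x; have [v ev'] := pres_surj fR y.
    apply: (sg_eq (u := u ++ v)); last by apply: sg_mul; [apply: IHx | apply: IHy].
    by apply/(pres_evP fR); rewrite ev_cat eu ev' -ew.
Qed.

End Presented.

(** * The Andreadakis filtration *)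

Definition andreadakis (G : groupType) (j : nat) (f : G -> G) : Prop :=
  forall i g, 0 < i -> lcsg i g -> lcsg (i + j) (f g * g^-1).

Section Andreadakis.
Variable G : groupType.

Lemma quo_eq (Q : groupType) (q : G -> Q) k : {morph q : x y / x * y} ->
  (forall x, q x = 1 <-> lcsg k x) -> forall x y, q x = q y <-> lcsg k (x * y^-1).
Proof.
move=> qM qE x y; rewrite -qE qM (morV qM); split=> [->|/divg1_eq //].
by rewrite mulgV.
Qed.

(** Triviality on the abelianization propagates: on [g, h] with g in Gamma_(i+1), the errors a in
    Gamma_(i+2) and b in Gamma_2 are such that, modulo Gamma_(i+3), a is central and b commutes with
    Gamma_(i+1), so [cm_absorb] applies. *)
Lemma andreadakis1 (f : G -> G) : {morph f : x y / x * y} ->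
  (forall g, lcsg 2 (f g * g^-1)) -> andreadakis 1 f.
Proof.
move=> fM f2 i g; elim: i g => [|[|i] IH] // g _ hg.
have [Q [q [qM qE]]] := lcsg_quotient G (i.+2 + 1).
rewrite -(quo_eq qM qE); elim: g / hg => [x [g [h [hg ->]]]|||].
- have {}hg : lcsg i.+1 g by [].
  pose a := f g * g^-1; pose b := f h * h^-1.
  have ha : lcsg i.+2 a by rewrite -(addn1 i.+1); apply: IH.
  have hb : lcsg 2 b by apply: f2.
  have qa z : commute (q a) (q z).
    by rewrite -cm_eq1 -(mor_cm qM) qE addn1; apply: lcsg_cm.
  have qb z : lcsg i.+1 z -> commute (q b) (q z).
    move=> hz; rewrite -cm_eq1 -(mor_cm qM) qE addnC (_ : 1 + i.+2 = 2 + i.+1)%N //.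
    exact: lcsg_cmm.
  have ea : f g = a * g by rewrite mulgVK.
  have eb : f h = b * h by rewrite mulgVK.
  clearbody a b.
  rewrite (mor_cm fM) ea eb !(mor_cm qM) !qM; apply: cm_absorb.
  + exact: qa.
  + exact: qa.
  + exact: qa.
  + exact: qb.
  + by have := qb _ (lcsg_cj h (lcsgV hg)); rewrite (mor_cj qM) (morV qM).
- by rewrite (mor1 fM).
- by move=> x _ e; rewrite (morV fM) !(morV qM) e.
- by move=> x y _ ex _ ey; rewrite fM !qM ex ey.
Qed.

Variables (H : groupType) (act : H -> G -> G).
Hypothesis actM : forall b, {morph act b : x y / x * y}.
Hypothesis act_mul : forall a b g, act (a * b) g = act b (act a g).
Hypothesis act_1 : forall g, act 1 g = g.

Lemma andreadakis_act1 j : andreadakis j (act 1).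
Proof. by move=> i g _ _; rewrite act_1 mulgV; apply: lcsg_1. Qed.

Lemma andreadakis_mul j a b :
  andreadakis j (act a) -> andreadakis j (act b) -> andreadakis j (act (a * b)).
Proof.
move=> ha hb i g i0 hg; rewrite act_mul.
have -> : act b (act a g) * g^-1 = act b (act a g * g^-1) * (act b g * g^-1).
  by rewrite actM (morV (actM b)); gsimp.
apply: lcsgM; last exact: hb.
exact: (lcsg_mor (actM b)) (ha _ _ i0 hg).
Qed.

Lemma andreadakis_inv j a : andreadakis j (act a) -> andreadakis j (act a^-1).
Proof.
move=> ha i g i0 hg.
have -> : act a^-1 g * g^-1 = act a^-1 ((act a g * g^-1)^-1).
  by rewrite invgM invgK actM (morV (actM _)) -act_mul mulgV act_1.
exact: (lcsg_mor (actM _)) (lcsgV (ha _ _ i0 hg)).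
Qed.

(** With u and v the displacements of g under a and b, the products ab and ba send g to u v g and v
    u g modulo Gamma_(k+i+1), and there u and v commute because u is in Gamma_(k+i) and v in
    Gamma_(k+1). *)
Lemma andreadakis_cm i a b : 0 < i -> andreadakis i (act a) -> andreadakis 1 (act b) ->
  andreadakis i.+1 (act (cm a b)).
Proof.
move=> i0 ha hb k g k0 hg.
have [Q [q [qM qE]]] := lcsg_quotient G (k + i.+1).
have qeq := quo_eq qM qE.
have e : q (act (a * b) g) = q (act (b * a) g).
  pose u := act a g * g^-1; pose v := act b g * g^-1.
  have hu : lcsg (k + i) u by apply: ha.
  have hv : lcsg (k + 1) v by apply: hb.
  have eu : act a g = u * g by rewrite mulgVK.
  have ev : act b g = v * g by rewrite mulgVK.
  clearbody u v.
  rewrite !act_mul eu ev !actM eu ev !mulgA !qM; congr (_ * _).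
  have -> : q (act b u) = q u.
    by apply/qeq; rewrite addnS -addn1; apply: hb; rewrite // addn_gt0 k0.
  have -> : q (act a v) = q v.
    by apply/qeq; rewrite -add1n addnA; apply: ha; rewrite // addn_gt0 k0.
  suff : commute (q u) (q v) by [].
  rewrite -cm_eq1 -(mor_cm qM) qE; apply: (@lcsg_le _ _ ((k + i) + (k + 1))).
    by rewrite addnS -(addn1 (k + i)) leq_add2l addn1.
  by apply: lcsg_cmm; rewrite // addn1.
have -> : cm a b = a * b * (b * a)^-1 by rewrite /cm; gsimp.
have -> : act (a * b * (b * a)^-1) g * g^-1
    = act (b * a)^-1 (act (a * b) g * (act (b * a) g)^-1).
  rewrite act_mul [in RHS]actM; congr (_ * _).
  by rewrite (morV (actM _)) -act_mul mulgV act_1.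
by apply: (lcsg_mor (actM _)); apply/qeq.
Qed.

Lemma lcsg_andreadakis j b : (forall b, andreadakis 1 (act b)) -> 0 < j ->
  lcsg j b -> andreadakis j (act b).
Proof.
move=> h1; elim: j b => [|[|j] IH] b // _ hb.
elim: b / hb => [x [a [b [ha ->]]]|||].
- by apply: andreadakis_cm => //; apply: IH.
- exact: andreadakis_act1.
- by move=> x _; apply: andreadakis_inv.
- by move=> x y _ hx _; apply: andreadakis_mul.
Qed.

End Andreadakis.

(** * Magnus expansion *)

Section Magnus.
Import GRing.Theory.
Local Open Scope ring_scope.
Variable T : eqType.
Implicit Types (f g h : seq T -> int) (s t : seq T) (u v w : word T).

Definition sign (b : bool) : int := if b then -1 else 1.

(* The coefficient of the monomial s in the image of w under x_a |-> 1 + X_a, where monomials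
   with a repeated letter are set to 0, so that (1 + X_a)^-1 = 1 - X_a.  The value is
   meaningful only when s has no repetition. *)
Fixpoint mu w s : int :=
  if w is (a, b) :: w' then
    mu w' s + (if s is c :: s' then if c == a then sign b * mu w' s' else 0 else 0)
  else (s == [::])%:R.

(* Product of noncommutative power series. *)
Fixpoint conv f g s : int :=
  if s is a :: s' then f [::] * g s + conv (fun t => f (a :: t)) g s'
  else f [::] * g [::].

Lemma eq_conv f f' g g' s :
  (forall s1 s2, s = s1 ++ s2 -> f s1 * g s2 = f' s1 * g' s2) ->
  conv f g s = conv f' g' s.
Proof.
elim: s f f' => [|a s IH] f f' e /=; first exact: (e [::] [::]).
rewrite (e [::] (a :: s)) //; congr (_ + _); apply: IH => s1 s2 es.
by apply: (e (a :: s1)); rewrite es.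
Qed.

Lemma conv1l g s : conv (fun t => (t == [::])%:R) g s = g s.
Proof.
case: s => [|a s] /=; first by rewrite mul1r.
rewrite mul1r -[RHS]addr0; congr (_ + _).
by elim: s => [|b s IH] /=; rewrite mul0r ?add0r.
Qed.

Lemma conv1r f s : conv f (fun t => (t == [::])%:R) s = f s.
Proof.
elim: s f => [|a s IH] f /=; first by rewrite mulr1.
by rewrite mulr0 add0r IH.
Qed.

Lemma convDl f f' g s (c : int) :
  conv (fun t => f t + c * f' t) g s = conv f g s + c * conv f' g s.
Proof.
elim: s f f' => [|a s IH] f f' /=; first by ring.
by rewrite IH; ring.
Qed.

Lemma mu_cat u v s : mu (u ++ v) s = conv (mu u) (mu v) s.
Proof.
elim: u s => [|[a b] u IH] s /=; first by rewrite conv1l.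
case: s => [|c s] /=; first by rewrite !addr0 IH.
rewrite !IH /=; case: (c == a); last first.
  by rewrite !addr0; congr (_ + _); apply: eq_conv => s1 s2 _; rewrite addr0.
rewrite convDl addr0; ring.
Qed.

Lemma mu_nil w : mu w [::] = 1.
Proof. by elim: w => [|[a b] w IH] //=; rewrite IH addr0. Qed.

Lemma mu_rcons w a b s c :
  mu (w ++ [:: (a, b)]) (rcons s c) = mu w (rcons s c) + (if c == a then sign b * mu w s else 0).
Proof.
elim: w s => [|[d e] w IH] s /=.
  case: s => [|x s] /=; first by case: eqP => // _; ring.
  have -> : rcons s c == [::] = false by case: s.
  by case: (x == a); case: (c == a); rewrite ?mulr0 ?addr0 /=.
rewrite IH; case: s => [|x s] /=.
  case: (c == a); case: (c == d); rewrite -?[X in mu (w ++ _) X]/([::]) ?mu_nil //; ring.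
by rewrite IH; case: (c == a); case: (x == d) => //; ring.
Qed.

Lemma mu_notin w a s : (forall b, (a, b) \notin w) -> a \in s -> mu w s = 0.
Proof.
elim: w s => [|[d b] w IH] s hw has_a /=; first by case: s has_a.
have hw' c : (a, c) \notin w by have := hw c; rewrite inE negb_or => /andP[].
rewrite (IH _ hw' has_a) add0r; case: s has_a => // c s.
rewrite inE; case: (c =P d) => // -> /orP[/eqP ad|has_a].
  by have := hw b; rewrite inE ad eqxx.
by rewrite IH ?mulr0.
Qed.

(** The retraction x_a |-> 1, which on expansions keeps the monomials without X_a. *)
Definition kill a w : word T := [seq x <- w | x.1 != a].

Lemma kill_notin a w b : (a, b) \notin kill a w.
Proof. by rewrite mem_filter eqxx. Qed.

Lemma mu_kill a w s : a \notin s -> mu (kill a w) s = mu w s.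
Proof.
elim: w s => [|[d b] w IH] s has_a //=.
case: (d =P a) => [->|_] /=.
  rewrite (IH _ has_a); case: s has_a => [|c s]; rewrite ?addr0 //.
  by rewrite inE eq_sym; case: eqP => //; rewrite addr0.
rewrite (IH _ has_a); case: s has_a => // c s; rewrite inE negb_or => /andP[_ h].
by rewrite IH.
Qed.

(** Congruence modulo degree j. Monomials with a repetition are left out because [mu] does not
    respect cancellation on them. *)
Definition agree (j : nat) f g := forall s, uniq s -> (size s < j)%N -> f s = g s.

Lemma agree_conv j f f' g g' :
  agree j f f' -> agree j g g' -> agree j (conv f g) (conv f' g').
Proof.
move=> hf hg s us ss; apply: eq_conv => s1 s2 e.
move: us ss; rewrite e cat_uniq size_cat => /and3P[u1 _ u2] ss.
rewrite hf ?hg //; [apply: leq_ltn_trans ss|apply: leq_ltn_trans ss].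
  exact: leq_addl.
exact: leq_addr.
Qed.

Lemma agree_cat j u u' v v' : agree j (mu u) (mu u') -> agree j (mu v) (mu v') ->
  agree j (mu (u ++ v)) (mu (u' ++ v')).
Proof.
by move=> hu hv s us ss; rewrite !mu_cat; apply: (agree_conv hu hv).
Qed.

Lemma agree_cancel j u v a b : agree j (mu (u ++ (a, b) :: (a, ~~ b) :: v)) (mu (u ++ v)).
Proof.
apply: agree_cat => // s us _ /=.
case: s us => [|c s] /=; rewrite ?addr0 //; case: (c =P a) => [->|_]; rewrite ?addr0 //.
case: s => [|d s] /=; rewrite ?addr0.
  by move=> _; case: b; rewrite /sign /=; ring.
rewrite inE negb_or eq_sym => /andP[/andP[/negPf -> _] _].
by case: b; rewrite /sign /=; ring.
Qed.

Lemma conv_mu u v s : s != [::] ->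
  (forall s1 s2, s = s1 ++ s2 -> s1 != [::] -> s2 != [::] -> mu u s1 * mu v s2 = 0) ->
  conv (mu u) (mu v) s = mu u s + mu v s.
Proof.
case: s => [|a s] //= _ h; rewrite mu_nil mul1r addrC; congr (_ + _).
rewrite -[RHS](conv1r (fun t => mu u (a :: t))); apply: eq_conv => s1 s2 e.
case: s2 e => [|b s2] e /=; first by rewrite mu_nil.
by rewrite mulr0; apply: h; rewrite ?e.
Qed.

End Magnus.

(** * The truncated Magnus expansion as an invariant of RF_n *)

Section MagnusRF.
Variable n : nat.
Implicit Types (u v w : word 'I_n).
Local Open Scope ring_scope.
Import GRing.Theory.

Lemma agree_pres R j u v : (forall r, R r -> agree j (mu r) (mu [::])) ->
  pres_eq R u v -> agree j (mu u) (mu v).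
Proof.
move=> hR; elim=> {u v} [u|u v _ IH|u v w _ IH1 _ IH2|u v a b|u v r /hR hr] s us ss //.
- by rewrite IH.
- by rewrite IH1 ?IH2.
- by rewrite (@agree_cancel _ j).
- apply: (agree_cat (j := j)) => // {us ss}s us ss.
  by rewrite mu_cat -[RHS]conv1l; apply: (agree_conv (j := j)) => // t ut st; apply: hr.
Qed.

Lemma agree_free j u v : pres_eq (fun _ => False) u v -> agree j (mu u) (mu v).
Proof. exact: agree_pres. Qed.

Lemma agree_mulVr j u v w : agree j (mu (u ++ w)) (mu (v ++ w)) -> agree j (mu u) (mu v).
Proof.
move=> h; have k t : agree j (mu ((t ++ w) ++ inv_word w)) (mu t).
  rewrite -catA; apply: agree_free; rewrite -{2}(cats0 t).
  exact: pe_cat (pe_refl _ _) (pe_invr _ _).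
move=> s us ss; rewrite -(k u) // -(k v) //.
by apply: (agree_cat (j := j)) us ss.
Qed.

(** Trades the expansion of a commutator, with its two inverses, for a comparison of two
    products. *)
Lemma agree_comm j u v :
  agree j (mu (comm_word u v)) (mu [::]) <-> agree j (mu (u ++ v)) (mu (v ++ u)).
Proof.
have e : pres_eq (fun _ => False) (comm_word u v ++ (v ++ u)) (u ++ v).
  rewrite /comm_word -!catA -[X in pres_eq _ _ (u ++ X)]cats0.
  apply: pe_cat (pe_refl _ _) _; apply: pe_cat (pe_refl _ _) _.
  apply: pe_trans (pe_invl _ u); apply: pe_cat (pe_refl _ _) _.
  by rewrite catA -{2}(cat0s u); apply: pe_cat (pe_invl _ _) (pe_refl _ _).
split=> h.
  move=> s us ss; rewrite -(agree_free (j := j) e) //.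
  by rewrite -[in RHS](cat0s (v ++ u)); apply: (agree_cat (j := j) h).
apply: (@agree_mulVr _ _ _ (v ++ u)) => s us ss.
by rewrite (agree_free (j := j) e) // h.
Qed.

Lemma kill_cat a u v : kill a (u ++ v) = kill a u ++ kill a v.
Proof. exact: filter_cat. Qed.

Lemma kill_inv a u : kill a (inv_word u) = inv_word (kill a u).
Proof. by rewrite /kill /inv_word filter_rev filter_map. Qed.

(* Every monomial of the expansion of a conjugate of x_i, except 1, contains X_i; hence this
   expansion commutes with 1 + X_i once monomials with a repetition are discarded. *)
Lemma agree_RF j (r : word 'I_n) : RF_rel r -> agree j (mu r) (mu [::]).
Proof.
move=> [i [u ->]]; apply/agree_comm.
set v := conj_word _ _; have hv s : uniq s -> i \notin s -> mu v s = (s == [::])%:R.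
  move=> us /mu_kill <-; rewrite -[RHS]/(mu [::] s).
  have e : pres_eq (fun _ => False) (kill i v) [::].
    by rewrite /v /conj_word !kill_cat kill_inv /= eqxx; apply: pe_invl.
  exact: (agree_free (j := (size s).+1) e).
move=> s us ss; transitivity (mu v s + (s == [:: i])%:R).
  case: s us {ss} => [|c s] /=; first by rewrite !addr0.
  case: (c =P i) => [->|/eqP ci] /andP[h us]; last first.
    by rewrite eqseq_cons (negPf ci).
  by rewrite (hv s) // /sign mul1r eqseq_cons eqxx.
case/lastP: s us {ss} => [|s c]; first by rewrite !mu_nil.
rewrite rcons_uniq mu_rcons; case: (c =P i) => [->|/eqP ci] /andP[h us].
  rewrite (hv s) // /sign mul1r; congr (_ + _); case: s {h us} => [|x s] /=; first by rewrite eqxx.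
  by rewrite eqseq_cons; case: s => [|y s] /=; rewrite andbF.
congr (_ + _); case: s {h us} => [|x s] /=; first by rewrite eqseq_cons (negPf ci).
by rewrite eqseq_cons; case: s => [|y s] /=; rewrite andbF.
Qed.

(** For g in Gamma_(k+1) and any h, the expansions of gh and hg agree up to degree k + 1: below it g
    counts as 1, and in degree k + 1 a mixed product would need a term of g of degree between 1 and
    k, so both coefficients are the sum of those of g and h. *)
Lemma lcs_agree k w : (0 < k)%N -> lcs (@RF_rel n) k w -> agree k (mu w) (mu [::]).
Proof.
elim: k w => [|[|k] IH] w // _; first by move=> _ [|c s] //; rewrite !mu_nil.
elim=> {w} [w [g [h [/IH hg ->]]]||w _ IHw|u v _ IHu _ IHv|u v e _ IHu] //.
- apply/agree_comm => s us ss; rewrite !mu_cat.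
  case: (leqP (size s) k) => ssk.
    rewrite (agree_conv (f' := mu [::]) (g' := mu h) (hg isT)) // conv1l.
    by rewrite (agree_conv (f' := mu h) (g' := mu [::]) (j := k.+1)) ?conv1r //; exact: hg.
  have sk : size s = k.+1 by apply/eqP; rewrite eqn_leq ssk andbT -ltnS.
  have top s1 s2 : s = s1 ++ s2 -> s1 != [::] -> s2 != [::] -> mu g s1 = 0 /\ mu g s2 = 0.
    move=> e n1 n2; move: us sk; rewrite e cat_uniq size_cat => /and3P[u1 _ u2] sk.
    have z t : uniq t -> t != [::] -> (size t < k.+1)%N -> mu g t = 0.
      by move=> ut nt st; rewrite hg //; case: t nt {ut st}.
    split; apply: z => //; rewrite -sk.
      by rewrite -[X in (X < _)%N]addn0 ltn_add2l; case: (s2) n2.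
    by rewrite -[X in (X < _)%N]add0n ltn_add2r; case: (s1) n1.
  have s0 : s != [::] by case: (s) sk.
  rewrite (conv_mu (u := g) (v := h) s0); last first.
    by move=> s1 s2 e n1 n2; have [-> _] := top _ _ e n1 n2; rewrite mul0r.
  rewrite (conv_mu (u := h) (v := g) s0) 1?addrC // => s1 s2 e n1 n2.
  by have [_ ->] := top _ _ e n1 n2; rewrite mulr0.
- apply: (@agree_mulVr _ _ _ w) => s us ss.
  by rewrite (agree_free (j := k.+2) (pe_invl _ w)) // cat0s IHw.
- move=> s us ss; rewrite -[RHS]/(mu ([::] ++ [::]) s).
  exact: (agree_cat (j := k.+2)).
- move=> s us ss; rewrite -(agree_pres (j := k.+2) _ e) ?IHu //.
  exact: agree_RF.
Qed.

End MagnusRF.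

(** * The reduced free group *)

(** Additive notation for a subgroup generated by commuting elements, so that sums over monomials
    with integer coefficients make sense in it. *)
Lemma abelian_zmodType (G : groupType) (P : G -> Prop) :
    (forall x y, P x -> P y -> commute x y) ->
  exists (Z : zmodType) (e : Z -> G),
    [/\ forall a b : Z, e (a + b)%R = e a * e b, injective e &
        forall g, generated P g <-> exists a : Z, e a = g].
Proof.
move=> Pcom.
have com x y : generated P x -> generated P y -> commute x y.
  move=> hx hy; elim: x / hx => [x hx||x _|x x' _ hx _ hx'].
  - elim: y / hy => [y hy||y _|y y' _ hy _ hy'].
    + exact: Pcom.
    + exact: commute1.
    + exact: commuteV.
    + exact: commuteM.
  - exact/commute_sym/commute1.
  - by move=> h; apply/commute_sym/commuteV/commute_sym.
  - by apply/commute_sym/commuteM; apply/commute_sym.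
pose T : choiceType := {g : G | `[< generated P g >]}.
pose mk g (h : generated P g) : T := exist _ g (introT (asboolP _) h).
have gP (a : T) : generated P (val a) by apply/asboolP/(valP a).
pose add (a b : T) := mk _ (generatedM (gP a) (gP b)).
pose opp (a : T) := mk _ (generatedV (gP a)).
pose zero := mk _ (generated1 P).
have addA : associative add by move=> a b c; apply/val_inj/mulgA.
have addC : commutative add by move=> a b; apply/val_inj/com.
have add0 : left_id zero add by move=> a; apply/val_inj/mul1g.
have addN : left_inverse zero opp add by move=> a; apply/val_inj/mulVg.
exists (HB.pack_for zmodType T (GRing.isZmodule.Build T addA addC add0 addN)).
exists (fun a : T => val a); split=> // [|g]; first exact: val_inj.
split=> [h|[a <-]]; last exact: gP.
by exists (mk g h).
Qed.

Section ReducedFree.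
Variables (n : nat) (G : groupType) (x : 'I_n -> G).
Hypothesis xP : presents (@RF_rel n) x.
Implicit Types (i a m : 'I_n) (g h y : G).

Definition ncl i := generated (fun c => exists g, c = cj g (x i)).

Lemma ncl_gen i g : ncl i (cj g (x i)).
Proof. by apply: generated_base; exists g. Qed.

Lemma ncl_x i : ncl i (x i).
Proof. by rewrite -[x i]cj1; apply: ncl_gen. Qed.

Lemma ncl_cj i g y : ncl i y -> ncl i (cj g y).
Proof.
apply: generated_mor; first exact: cj_mor.
by move=> _ [h ->]; rewrite -cjM; apply: ncl_gen.
Qed.

Lemma x_comm_cj i g : commute (x i) (cj g (x i)).
Proof.
have [u <-] := pres_surj xP g; apply/cm_eq1.
have := @pres_rel _ _ _ _ xP (comm_word (gen i) (conj_word (gen i) (inv_word u))).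
rewrite ev_comm ev_conj ev_inv invgK ev_gen; apply.
by exists i, (inv_word u).
Qed.

Lemma cj_comm i g h : commute (cj g (x i)) (cj h (x i)).
Proof.
have -> : cj h (x i) = cj g (cj (g^-1 * h) (x i)) by rewrite -cjM mulgA mulgV mul1g.
by rewrite /commute -!(cj_mor g) x_comm_cj.
Qed.

Lemma ncl_abelian i : exists (Z : zmodType) (e : Z -> G),
    [/\ forall a b : Z, e (a + b)%R = e a * e b, injective e &
        forall g, ncl i g <-> exists a : Z, e a = g].
Proof. by apply: abelian_zmodType => _ _ [g ->] [h ->]; apply: cj_comm. Qed.

Lemma ncl_comm i y z : ncl i y -> ncl i z -> commute y z.
Proof.
have [Z [e [eD _ eP]]] := ncl_abelian i.
by move=> /eP[a <-] /eP[b <-]; rewrite /commute -!eD GRing.addrC.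
Qed.

Lemma ncl_cml i y z : ncl i y -> ncl i (cm y z).
Proof.
move=> hy; have -> : cm y z = y * cj z y^-1 by rewrite /cm /cj; gsimp.
by apply: generatedM => //; apply/ncl_cj/generatedV.
Qed.

Lemma ncl_cmr i y z : ncl i z -> ncl i (cm y z).
Proof.
move=> hz; have -> : cm y z = cj y z * z^-1 by [].
by apply: generatedM; [apply: ncl_cj | apply: generatedV].
Qed.

(** The right-normed commutator that corresponds to the monomial s X_m. *)
Fixpoint bracket m (s : seq 'I_n) : G :=
  if s is a :: s' then cm (x a) (bracket m s') else x m.

Lemma ncl_bracket m s i : i \in rcons s m -> ncl i (bracket m s).
Proof.
elim: s => [|a s IH] /=; first by rewrite inE => /eqP ->; apply: ncl_x.
rewrite inE => /orP[/eqP ->|/IH]; last exact: ncl_cmr.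
exact/ncl_cml/ncl_x.
Qed.

Lemma last_rcons_mem m s : m \in rcons s m.
Proof. by rewrite mem_rcons inE eqxx. Qed.

Lemma lcsg_bracket m s : lcsg (size s).+1 (bracket m s).
Proof.
elim: s => [|a s IH] //=.
have -> : cm (x a) (bracket m s) = (cm (bracket m s) (x a))^-1 by rewrite /cm; gsimp.
exact: lcsgV (lcsg_cm _ IH).
Qed.

Definition letter a (b : bool) : G := if b then (x a)^-1 else x a.

(* e identifies the abelian group Z with the normal closure of x_m. *)
Section Normal.
Variables (m : 'I_n) (Z : zmodType) (e : Z -> G).
Hypothesis eD : forall a b : Z, e (a + b)%R = e a * e b.
Hypothesis eI : injective e.
Hypothesis eP : forall g, ncl m g <-> exists a : Z, e a = g.
Import GRing.Theory.

Lemma emb0 : e 0%R = 1.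
Proof. by apply: (mulgI (e 0%R)); rewrite -eD addr0 mulg1. Qed.

Lemma embN z : e (- z)%R = (e z)^-1.
Proof. by apply: (mulgI (e z)); rewrite -eD addrN emb0 mulgV. Qed.

Lemma embMz P z (k : int) : P 1 -> (forall g h, P g -> P h -> P (g * h)) ->
  (forall g, P g -> P g^-1) -> P (e z) -> P (e (z *~ k)%R).
Proof.
move=> P1 PM PV Pz; have Pn l : P (e (z *+ l)%R).
  by elim: l => [|l IH]; rewrite ?mulr0n ?emb0 // mulrS eD; apply: PM.
by case: k => l; [exact: Pn | rewrite NegzE mulrNz embN; apply/PV/Pn].
Qed.

Lemma exists_bracket : exists c, forall s, e (c s) = bracket m s.
Proof.
have [c cE] := choice (fun s => (eP (bracket m s)).1 (ncl_bracket (last_rcons_mem m s))).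
by exists c.
Qed.

Lemma exists_conj g : exists k : {additive Z -> Z}, forall z, e (k z) = cj g (e z).
Proof.
have [k hk] : exists k, forall z, e (k z) = cj g (e z).
  suff /choice[k hk] : forall z, exists z', e z' = cj g (e z) by exists k.
  by move=> z; apply/eP/ncl_cj/eP; exists z.
have kD : {morph k : a b / a - b}%R.
  by move=> a b; apply: eI; rewrite hk !eD !embN cj_mor !hk (morV (cj_mor g)).
exists (HB.pack_for {additive Z -> Z} k (GRing.isZmodMorphism.Build Z Z k kD)).
exact: hk.
Qed.

Variable c : seq 'I_n -> Z.
Hypothesis cE : forall s, e (c s) = bracket m s.

(** From x_a B x_a^-1 = [x_a, B] B. If a occurs in s, both x_a and B lie in the abelian normal
    closure of x_a; otherwise [x_a, B] lies there and commutes with x_a, so the inverse letter only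
    changes the sign. This is multiplication by 1 + X_a or 1 - X_a, as in the recursion of [mu]. *)
Lemma conj_bracket a b s (k : Z -> Z) : (forall z, e (k z) = cj (letter a b) (e z)) ->
  k (c s) = (c s + (if a \in s then 0 else c (a :: s) *~ sign b))%R.
Proof.
move=> kE; have xl y : ncl a y -> cj (letter a b) y = y.
  move=> hy; have : ncl a (letter a b).
    by rewrite /letter; case: (b); [apply: generatedV|]; apply: ncl_x.
  by move=> /(ncl_comm hy) hc; rewrite /cj -hc mulgK.
apply: eI; rewrite kE; case: ifP => as_; rewrite ?addr0.
  by rewrite xl // cE; apply: ncl_bracket; rewrite mem_rcons inE as_ orbT.
rewrite addrC eD {xl kE}.
have h0 : ncl a (bracket m (a :: s)) by apply: ncl_bracket; rewrite inE eqxx.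
have h1 : commute (bracket m (a :: s)) (x a) by apply: ncl_comm (ncl_x a).
have h2 : e (c (a :: s)) * e (c s) = cj (x a) (e (c s)).
  by rewrite !cE /= /cm /cj; gsimp.
case: b; rewrite /letter /sign; last by rewrite mulr1z h2.
rewrite mulrN1z embN; apply: (mulgI (e (c (a :: s)))); rewrite [RHS]mulgA mulgV mul1g.
have -> : e (c (a :: s)) = cj (x a)^-1 (e (c (a :: s))).
  rewrite cE; move: (bracket m (a :: s)) h1 => B h1.
  by rewrite /cj invgK -mulgA h1 mulKg.
by rewrite -cj_mor h2 -cjM mulVg cj1.
Qed.

Variable L : seq (seq 'I_n).
Hypothesis L_uniq : uniq L.
Hypothesis LE : forall s, (s \in L) = uniq s && (m \notin s).

Definition phi (f : seq 'I_n -> int) : Z := (\sum_(s <- L) c s *~ f s)%R.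

(** Prepending [a] is a bijection from the monomials of [L] without [a] to those starting with [a].
    It moves the shift from the brackets to their coefficients. *)
Lemma reindex_cons a F : a != m ->
  (\sum_(s <- L | a \notin s) F (a :: s) =
   \sum_(s <- L) (if s is d :: s' then if d == a then F s else 0 else 0) :> Z)%R.
Proof.
move=> am; pose hd s := if s is d :: _ then d == a else false.
transitivity (\sum_(s <- L | hd s) F s)%R; last first.
  by rewrite big_mkcond; apply: eq_bigr => -[].
rewrite -big_filter -(big_map (cons a) xpredT F) -[RHS]big_filter.
apply: perm_big; apply: uniq_perm; rewrite ?filter_uniq //.
  by rewrite map_inj_uniq ?filter_uniq // => s t [].
move=> s; rewrite mem_filter LE; apply/mapP/andP => [[t + ->]|[]].
  rewrite mem_filter LE /= eqxx inE negb_or eq_sym am => /andP[-> /andP[-> ->]].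
  by [].
case: s => // d s /eqP -> /= /andP[/andP[das us]]; rewrite inE negb_or => /andP[_ ms].
by exists s => //; rewrite mem_filter das LE us ms.
Qed.

Lemma phiD f f' : (phi (fun s => f s + f' s) = phi f + phi f')%R.
Proof. by rewrite /phi -big_split; apply: eq_bigr => s _; rewrite mulrzDr. Qed.

Lemma eq_phi f f' : {in L, f =1 f'} -> phi f = phi f'.
Proof. by move=> ff'; apply: eq_big_seq => s hs; rewrite ff'. Qed.

(* Decomposition of w along the split extension ncl m -> RF_n -> RF_n / x_m: the coefficients
   on the commutators [x_a1, [x_a2, ..., x_m]] are read off the monomials ending in X_m. *)
Lemma ev_phi w : ev x w = e (phi (fun s => mu w (rcons s m))) * ev x (kill m w).
Proof.
elim: w => [|[a b] w IH].
  rewrite mulg1 /phi big1 ?emb0 // => s _.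
  by case: s => [|d s]; rewrite /= mulr0z.
rewrite [LHS]/= -/(letter a b) IH {IH} [kill m _]/=.
set f := (fun s => mu w (rcons s m)).
have -> : phi (fun s => mu ((a, b) :: w) (rcons s m)) = (phi f + phi (fun s =>
    if rcons s m is d :: s' then if d == a then (sign b * mu w s')%R else 0 else 0))%R.
  by rewrite -phiD.
(* A letter x_m only affects the coefficient of X_m itself, since [m] is not in [s], and that
   coefficient belongs to the empty bracket x_m. *)
case: (a =P m) => [->|/eqP am] /=.
  rewrite eqxx mulgA addrC; congr (_ * _); rewrite eD; congr (_ * _).
  rewrite (@eq_phi _ (fun s => if s == [::] then sign b else 0)).
    rewrite /phi (bigD1_seq [::]) ?LE //= big1 ?addr0.
      by rewrite /letter /sign; case: (b); rewrite ?mulrN1z ?embN ?mulr1z cE.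
    by move=> s /negPf ->; rewrite mulr0z.
  move=> [|d s] /=; rewrite ?eqxx ?mu_nil ?mulr1 //.
  by rewrite LE inE negb_or eq_sym => /and3P[_ /negPf -> _].
rewrite am.
(* A letter other than x_m passes to the right of the factor in the normal closure by conjugating
   it. *)
have [k kE] := exists_conj (letter a b).
have -> : (phi f + phi (fun s =>
    if rcons s m is d :: s' then if d == a then (sign b * mu w s')%R else 0 else 0))%R = k (phi f).
  rewrite /phi raddf_sum.
  under [RHS]eq_bigr => s _ do rewrite raddfMz (conj_bracket _ kE) mulrzDl.
  rewrite big_split /=; congr (_ + _)%R.
  transitivity (\sum_(s <- L | a \notin s)
      (c (a :: s) *~ sign b *~ f (behead (a :: s))))%R; last first.
    rewrite big_mkcond; apply: eq_bigr => s _; case: (a \in s) => //=.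
    by rewrite mul0rz.
  rewrite (reindex_cons (fun s => (c s *~ sign b *~ f (behead s))%R)) //.
  apply: eq_bigr => -[|d s] _ /=; first by rewrite eq_sym (negPf am) mulr0z.
  by case: eqP => // _; rewrite ?mulr0z // mulrzA.
by rewrite kE /cj; gsimp.
Qed.

End Normal.

Lemma uniq_seqs m : exists2 L : seq (seq 'I_n), uniq L &
  forall s, (s \in L) = uniq s && (m \notin s).
Proof.
exists [seq s <- [seq val s | s : n.-bseq 'I_n] | uniq s && (m \notin s)].
  rewrite filter_uniq // map_inj_uniq ?enum_uniq //; exact: val_inj.
move=> s; rewrite mem_filter; case: (boolP (uniq s && _)) => //= /andP[us _].
have ss : size s <= n by rewrite -(card_uniqP us) -[X in _ <= X]card_ord max_card.
by apply/mapP; exists (Bseq ss); rewrite ?mem_enum.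
Qed.

(* The dimension subgroups of RF_n are its lower central subgroups. *)
Lemma agree_lcsg j w : 0 < j -> agree j (mu w) (mu [::]) -> lcsg j (ev x w).
Proof.
move=> j0; have : forall a, a \in map fst w -> a \in enum 'I_n by move=> a; rewrite mem_enum.
(* [K] bounds the generators that may still occur in [w]; each round splits off the normal closure
   of one of them. *)
move: {1}(enum _) => K; elim: K w => [|m K IH] w.
  case: w => [|a w] h; first by move=> _; apply: lcsg_1.
  by have := h a.1; rewrite inE eqxx => /(_ isT).
move=> wK hw.
have [Z [e [eD eI eP]]] := ncl_abelian m.
have [c cE] := exists_bracket eP.
have [L uL LE] := uniq_seqs m.
rewrite (ev_phi eD eI eP cE uL LE); apply: lcsgM.
  rewrite /phi big_seq; apply: (big_ind (fun z => lcsg j (e z))).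
  - by rewrite (emb0 eD); apply: lcsg_1.
  - by move=> y z hy hz; rewrite eD; apply: lcsgM.
  move=> s; rewrite LE => /andP[us ms].
  (* The monomial s X_m has degree [(size s).+1]: either its bracket is already in Gamma_j, or its
     coefficient vanishes by [hw]. *)
  case: (leqP j (size s).+1) => sj.
    apply: (embMz eD); [exact: lcsg_1|exact: lcsgM|exact: lcsgV|].
    by rewrite cE; apply: lcsg_le sj (lcsg_bracket _ _).
  rewrite hw ?rcons_uniq ?ms ?size_rcons //.
  by case: (s) => [|d t]; rewrite /= mulr0z (emb0 eD); apply: lcsg_1.
apply: IH => [a /mapP[[d b]]|s us ss].
  rewrite mem_filter /= => /andP[dm dw] ->.
  have /wK : d \in map fst w by apply/mapP; exists (d, b).
  by rewrite inE (negPf dm).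
case: (boolP (m \in s)) => ms; last by rewrite mu_kill // hw.
rewrite (@mu_notin _ _ m) //; first by case: (s) ms.
by move=> b; apply: kill_notin.
Qed.

End ReducedFree.

(** * The homotopy Artin action *)

Definition letter_img n (a : ('I_n * 'I_n) * bool) (k : 'I_n) : word 'I_n :=
  if a.1.1 < a.1.2 then
    (if a.2 then artin_img_inv id a.1.1 a.1.2 else artin_img id a.1.1 a.1.2) k
  else gen k.

Lemma subst_gen T (w : word T) : subst_word gen w = w.
Proof. by elim: w => [|[a []] w IH] //; rewrite -[in RHS]IH. Qed.

Lemma ev_letter n (G : groupType) (x : 'I_n -> G) a w :
  ev x (artin_letter a w) = ev (fun k => ev x (letter_img a k)) w.
Proof.
rewrite -ev_subst /artin_letter /letter_img; case: ifP => // _.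
by rewrite -{1}(subst_gen w).
Qed.

(** The two substitutions are inverse already in the free group, so each case is an identity between
    words. *)
Lemma letter_imgK n (G : groupType) (x : 'I_n -> G) r s b k :
  ev (fun k => ev x (letter_img (r, s, b) k)) (letter_img (r, s, ~~ b) k) = x k.
Proof.
rewrite /letter_img /=; case: (ltnP r s) => rs; last by rewrite !ev_gen.
have sr : (s == r) = false by rewrite -val_eqE gtn_eqF.
rewrite /artin_img /artin_img_inv; case: b => /=.
all: case: (eqVneq k r) => [->|kr]; [|case: (eqVneq k s) => [->|ks]; [|case: ifP => rks]].
all: by rewrite /= ?eqxx ?sr ?(negPf kr) ?(negPf ks) ?rks /=; gsimp.
Qed.

Section Action.
Variables (n : nat) (G : groupType) (x : 'I_n -> G).
Hypothesis xP : presents (@RF_rel n) x.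
Implicit Types (i j k l m : 'I_n) (g h y : G) (a : ('I_n * 'I_n) * bool)
  (u v : word ('I_n * 'I_n)).

Lemma gen_ind (P : G -> Prop) : P 1 -> (forall g h, P g -> P h -> P (g * h)) ->
  (forall g, P g -> P g^-1) -> (forall k, P (x k)) -> forall g, P g.
Proof.
move=> P1 PM PV Px g; have [w <-] := pres_surj xP g.
by elim: w => [|[k []] w IH] //=; apply: PM => //; apply: PV.
Qed.

Lemma mor_ext (H : groupType) (f f' : G -> H) : {morph f : y z / y * z} ->
  {morph f' : y z / y * z} -> (forall k, f (x k) = f' (x k)) -> f =1 f'.
Proof.
move=> fM fM' e; apply: gen_ind => [|g h eg eh|g eg|//]; first by rewrite !mor1.
- by rewrite fM fM' eg eh.
- by rewrite !morV // eg.
Qed.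

(* x_r x_s x_r x_s^-1 x_r^-1 is also the conjugate of x_r by x_r x_s x_r^-1, which,
   unlike x_r x_s, lies in the normal closure of x_s. *)
Definition conjugator a k : G :=
  let r := a.1.1 in let s := a.1.2 in
  if ~~ (r < s) then 1
  else if a.2 then
    (if k == r then (x s)^-1 else if k == s then (x r)^-1
     else if (r < k) && (k < s) then cm (x s)^-1 (x r)^-1 else 1)
  else
    (if k == r then cj (x r) (x s) else if k == s then x r
     else if (r < k) && (k < s) then cm (x r) (x s) else 1).

Lemma ev_letter_img a k : ev x (letter_img a k) = cj (conjugator a k) (x k).
Proof.
case: a => -[r s] b; rewrite /letter_img /conjugator /=.
case: (ltnP r s) => rs; last by rewrite cj1 ev_gen.
case: b; rewrite /artin_img_inv /artin_img.
- case: (k =P r) => [->|_]; first by rewrite /= /cj; gsimp.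
  case: (k =P s) => [->|_] /=.
    (* The only case that uses the relations of RF_n: x_s commutes with x_r^-1 x_s x_r, so the outer
       x_s^-1 and x_s cancel. *)
    rewrite mulg1 /cj invgK; have := x_comm_cj xP s (x r)^-1; rewrite /cj invgK => h.
    have -> : (x s)^-1 * ((x r)^-1 * (x s * (x r * x s)))
      = (x s)^-1 * ((x r)^-1 * x s * x r * x s) by gsimp.
    by rewrite -h mulKg.
  by case: ifP => _; rewrite /= /cj /cm; gsimp.
- case: (k =P r) => [->|_]; first by rewrite /= /cj; gsimp.
  case: (k =P s) => [->|_] /=; first by rewrite /= /cj; gsimp.
  by case: ifP => _; rewrite /= /cj /cm; gsimp.
Qed.

(** Each generator goes to a conjugate of itself, so a relator becomes a commutator of two
    conjugates of x_i. *)
Lemma letter_RF a r : RF_rel r -> ev (fun k => ev x (letter_img a k)) r = 1.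
Proof.
rewrite (eq_ev (ev_letter_img a)) => -[i [u ->]].
rewrite ev_comm ev_conj ev_gen cm_eq1 -cjM; exact: cj_comm.
Qed.

Lemma exists_letter_act : exists phi : ('I_n * 'I_n) * bool -> G -> G,
  forall a, {morph phi a : y z / y * z} /\
    forall w, phi a (ev x w) = ev x (artin_letter a w).
Proof.
suff /choice[phi h] : forall a, exists f : G -> G, {morph f : y z / y * z} /\
    forall w, f (ev x w) = ev x (artin_letter a w) by exists phi.
move=> a; have [f fM fE] := pres_lift xP (@letter_RF a).
by exists f; split=> // w; rewrite fE ev_letter.
Qed.

Variable phi : ('I_n * 'I_n) * bool -> G -> G.
Hypothesis phiM : forall a, {morph phi a : y z / y * z}.
Hypothesis phiE : forall a w, phi a (ev x w) = ev x (artin_letter a w).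

Lemma phi_x a k : phi a (x k) = cj (conjugator a k) (x k).
Proof. by rewrite -[X in phi a X](ev_gen x) phiE ev_letter ev_gen ev_letter_img. Qed.

Definition act u g : G := foldl (fun h a => phi a h) g u.

Lemma actE u w : act u (ev x w) = ev x (rho u w).
Proof. by elim: u w => [|a u IH] w //=; rewrite /act /= phiE -/(act u _) IH. Qed.

Lemma actM u : {morph act u : y z / y * z}.
Proof. by elim: u => [|a u IH] y z //; rewrite /act /= phiM -/(act u _) IH. Qed.

Lemma act_cat u v g : act (u ++ v) g = act v (act u g).
Proof. exact: foldl_cat. Qed.

Lemma phiK r s b : cancel (phi ((r, s), b)) (phi ((r, s), ~~ b)).
Proof.
apply: (mor_ext (f := fun g => phi _ (phi _ g)) (f' := id)) => // [y z|k].
  by rewrite !phiM.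
have -> : phi (r, s, b) (x k) = ev x (letter_img (r, s, b) k).
  by rewrite -[X in phi _ X](ev_gen x) phiE ev_letter ev_gen.
by rewrite phiE ev_letter; have := letter_imgK x r s (~~ b) k; rewrite negbK.
Qed.

End Action.

(** * Homotopy relations *)

(** The displacement f(y) y^-1 is a crossed homomorphism: that of yz is that of y times a conjugate
    of that of z. Generators therefore suffice when the target is stable under conjugation. *)
Lemma generated_displ (G : groupType) (f : G -> G) (P K : G -> Prop) :
    {morph f : y z / y * z} -> (forall g y, generated K y -> generated K (cj g y)) ->
    (forall y, P y -> generated K (f y * y^-1)) ->
  forall y, generated P y -> generated K (f y * y^-1).
Proof.
move=> fM KJ h y; elim=> {y} [y /h||y _ IH|y z _ IHy _ IHz] //.
- by rewrite (mor1 fM) mulgV; apply: generated1.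
- rewrite (morV fM) invgK; have -> : (f y)^-1 * y = cj y^-1 (f y * y^-1)^-1.
    by rewrite /cj; gsimp.
  exact/KJ/generatedV.
- rewrite fM; have -> : f y * f z * (y * z)^-1 = f y * y^-1 * cj y (f z * z^-1).
    by rewrite /cj; gsimp.
  by apply: generatedM => //; apply: KJ.
Qed.

Section Homotopy.
Variables (n : nat) (G : groupType) (x : 'I_n -> G).
Hypothesis xP : presents (@RF_rel n) x.
Implicit Types (i j k l m : 'I_n) (g h y : G) (a : ('I_n * 'I_n) * bool)
  (u v : word ('I_n * 'I_n)).

(* The form of the action of a word u in the A_mk, m < k, with w the image of u under
   A_mk |-> x_m. *)
Record basisconj k (f : G -> G) (w : G) : Prop := {
  bc_mor : {morph f : y z / y * z};
  bc_x : forall l, l != k -> exists2 c, ncl x k c & f (x l) = cj c (x l);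
  bc_k : f (x k) = cj w (x k) }.

Section BasisConj.
Variables (k : 'I_n) (f : G -> G) (w : G).
Hypothesis fP : basisconj k f w.
Let fM := bc_mor fP.

Lemma bc_ncl i y : ncl x i y -> ncl x i (f y).
Proof.
apply: (generated_mor fM) => _ [g ->]; rewrite (mor_cj fM).
case: (eqVneq i k) => [->|/(bc_x fP)[c _ ->]].
  by rewrite (bc_k fP) -cjM; apply: generated_base; eexists.
by rewrite -cjM; apply: generated_base; eexists.
Qed.

(** Modulo the normal closure of x_k, x_k is trivial and so are the conjugators of the other
    generators. *)
Lemma bc_displ g : ncl x k (f g * g^-1).
Proof.
apply: (generated_displ (P := fun y => exists l, y = x l)) => //.
- by move=> h y; apply: ncl_cj.
- move=> _ [l ->]; case: (eqVneq l k) => [->|/(bc_x fP)[c ck ->]].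
    rewrite (bc_k fP); apply: generatedM; first exact: ncl_gen.
    exact/generatedV/ncl_x.
  have -> : cj c (x l) * (x l)^-1 = c * cj (x l) c^-1 by rewrite /cj; gsimp.
  by apply: generatedM => //; apply/ncl_cj/generatedV.
apply: (gen_ind xP) => [|y z|y|l]; [exact: generated1|exact: generatedM|exact: generatedV|].
by apply: generated_base; exists l.
Qed.

Lemma ncl_cj_fix i y z : ncl x i y -> ncl x i z -> cj y z = z.
Proof. by move=> hy hz; rewrite /cj (ncl_comm xP hy hz) mulgK. Qed.

(** f(g) and g differ by an element of the normal closure of x_k, which is abelian, so both
    conjugate elements of this closure in the same way. Hence the words w multiply under
    composition. *)
Lemma bc_cjk g : f (cj g (x k)) = cj (g * w) (x k).
Proof.
rewrite (mor_cj fM) (bc_k fP) -[f g](mulgVK g) cjM -(cjM g w) (ncl_cj_fix (i := k)) //.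
  exact: bc_displ.
exact: ncl_gen.
Qed.

End BasisConj.

Lemma bc_id k : basisconj k id 1.
Proof.
split=> // [l _|]; last by rewrite cj1.
by exists 1; [apply: generated1|rewrite cj1].
Qed.

Lemma bc_comp k f w f' w' : basisconj k f w -> basisconj k f' w' ->
  basisconj k (fun g => f' (f g)) (w * w').
Proof.
move=> fP fP'; split=> [y z|l lk|].
- by rewrite (bc_mor fP) (bc_mor fP').
- have [c ck ->] := bc_x fP lk; have [c' ck' e] := bc_x fP' lk.
  exists (f' c * c'); first by apply: generatedM => //; exact: bc_ncl fP' _ _ ck.
  by rewrite (mor_cj (bc_mor fP')) e cjM.
- by rewrite (bc_k fP) (bc_cjk fP').
Qed.

Variables (j k : 'I_n).
Hypothesis jk : j != k.

(** All errors met when comparing A_jk with its conjugates land in this subgroup. It lies in both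
    abelian normal closures, hence commutes with each of them. *)
Definition mixed := generated (fun z => exists y y', [/\ ncl x j y, ncl x k y' & z = cm y y']).

Lemma mixed_cj g y : mixed y -> mixed (cj g y).
Proof.
apply: generated_mor; first exact: cj_mor.
move=> _ [y1 [y2 [h1 h2 ->]]]; apply: generated_base; exists (cj g y1), (cj g y2).
by rewrite (mor_cm (cj_mor g)); split=> //; apply: ncl_cj.
Qed.

Lemma mixed_nclj y : mixed y -> ncl x j y.
Proof.
elim=> {y} [_ [y [y' [hy _ ->]]]||y _|y z _ hy _]; first exact: ncl_cml.
- exact: generated1.
- exact: generatedV.
- exact: generatedM.
Qed.

Lemma mixed_nclk y : mixed y -> ncl x k y.
Proof.
elim=> {y} [_ [y [y' [_ hy ->]]]||y _|y z _ hy _]; first exact: ncl_cmr.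
- exact: generated1.
- exact: generatedV.
- exact: generatedM.
Qed.

Lemma bc_mixed f w y : basisconj k f w -> mixed y -> mixed (f y).
Proof.
move=> fP; apply: (generated_mor (bc_mor fP)) => _ [y1 [y2 [h1 h2 ->]]].
rewrite (mor_cm (bc_mor fP)); apply: generated_base; exists (f y1), (f y2).
by split=> //; apply: (bc_ncl fP).
Qed.

(* A stands for A_jk; it acts trivially on [ncl j, ncl k] and on ncl k modulo [ncl j, ncl k]. *)
Section Generator.
Variable A : G -> G.
Hypothesis AP : basisconj k A (x j).
Let AM := bc_mor AP.

Lemma gen_displ_nclk y : ncl x k y -> mixed (A y * y^-1).
Proof.
apply: (generated_displ AM mixed_cj) => _ [g ->]; rewrite (bc_cjk AP).
apply: generated_base; exists (cj g (x j)), (cj g (x k)).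
split; [exact: ncl_gen|exact: ncl_gen|].
by rewrite /cm /cj; gsimp.
Qed.

Lemma gen_displ_nclj y : ncl x j y -> mixed (A y * y^-1).
Proof.
apply: (generated_displ AM mixed_cj) => _ [g ->]; rewrite (mor_cj AM).
have [c ck ->] := bc_x AP jk; set z := A g * g^-1.
have zk : ncl x k z by apply: bc_displ AP g.
have -> : cj (A g) (cj c (x j)) = cj (z * cj g c) (cj g (x j)).
  by rewrite /z /cj; gsimp.
have dk : ncl x k (z * cj g c) by apply: generatedM => //; apply: ncl_cj.
set d := z * _ in dk *; clearbody d.
have -> : cj d (cj g (x j)) * (cj g (x j))^-1 = (cm (cj g (x j)) d)^-1.
  by rewrite /cm /cj; gsimp.
by apply/generatedV/generated_base; exists (cj g (x j)), d; split=> //; apply: ncl_gen.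
Qed.

(** A multiplies both entries of [y, y'] by elements of [mixed], and [cm_absorb] removes them. *)
Lemma gen_fix_mixed y : mixed y -> A y = y.
Proof.
elim=> {y} [_ [y [y' [hy hy' ->]]]||y _ IH|y z _ IHy _ IHz].
- have hd := gen_displ_nclj hy; have hd' := gen_displ_nclk hy'.
  rewrite (mor_cm AM) -[A y](mulgVK y) -[A y'](mulgVK y').
  move: (A y * y^-1) (A y' * y'^-1) hd hd' => d d' hd hd'.
  have dj := mixed_nclj hd; have dk := mixed_nclk hd.
  have dj' := mixed_nclj hd'; have dk' := mixed_nclk hd'.
  apply: cm_absorb.
  + exact: ncl_comm xP _ _ _ dj hy.
  + exact: ncl_comm xP _ _ _ dj dj'.
  + exact: ncl_comm xP _ _ _ dk hy'.
  + exact: ncl_comm xP _ _ _ dj' hy.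
  + by apply: (ncl_comm xP dj'); apply/ncl_cj/generatedV.
- exact: mor1.
- by rewrite (morV AM) IH.
- by rewrite AM IHy IHz.
Qed.

Variables (U U' : G -> G) (w : G).
Hypothesis UP : basisconj k U w.
Hypothesis UP' : basisconj k U' w^-1.
Hypothesis UK : cancel U' U.

Let B g := U (A (U' g)).

Lemma conj_bc : basisconj k B (w^-1 * x j * w).
Proof. exact: bc_comp (bc_comp UP' AP) UP. Qed.

Lemma conj_displ_nclk y : ncl x k y -> mixed (B y * y^-1).
Proof.
move=> hy; rewrite -{2}(UK y) /B -(morV (bc_mor UP)) -(bc_mor UP).
by apply: (bc_mixed UP); apply: gen_displ_nclk; apply: (bc_ncl UP').
Qed.

(** With A(b) = d b, one gets B(z) = U(d b z b^-1 d^-1) = U(d) z U(d)^-1, where U(d) is in [mixed]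
    and so is fixed by A. *)
Lemma conj_comm_fix z : A z = z -> (exists2 b, ncl x k b & U' z = cj b z) ->
  B (A z) = A (B z).
Proof.
move=> Az [b bk Uz]; rewrite Az.
suff [d dm ->] : exists2 d, mixed d & B z = cj d z.
  by rewrite (mor_cj AM) Az gen_fix_mixed.
have dm := gen_displ_nclk bk; set d := A b * b^-1 in dm.
exists (U d); first exact: bc_mixed UP dm.
rewrite /B Uz (mor_cj AM) Az -[A b](mulgVK b) -/d cjM (mor_cj (bc_mor UP)) -Uz.
by rewrite UK.
Qed.

(* Although A_jk moves x_l for j < l < k, it fixes x_k^-1 x_l x_k. *)
Hypothesis Ax : forall l, l != j -> l != k ->
  A (x l) = x l \/ A (cj (x k)^-1 (x l)) = cj (x k)^-1 (x l).

Lemma conj_comm g : B (A g) = A (B g).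
Proof.
have BP := conj_bc; have BM := bc_mor BP.
(* On x_k the two maps are conjugations by x_j and w^-1 x_j w, which commute in RF_n. *)
have BAk : B (A (x k)) = A (B (x k)).
  rewrite (bc_k AP) (bc_k BP) (bc_cjk BP) (bc_cjk AP); congr (cj _ _).
  by have := x_comm_cj xP j w^-1; rewrite /cj invgK.
apply: (mor_ext xP (f := fun g => B (A g)) (f' := fun g => A (B g))) => [y z|y z|l].
- by rewrite AM BM.
- by rewrite BM AM.
case: (eqVneq l k) => [-> //|lk].
have [c' ck' eU] := bc_x UP' lk.
case: (eqVneq l j) => [lj|lj].
  (* A and B conjugate x_j by c and d in the normal closure of x_k. Each changes the conjugator of
     the other by an element of [mixed], which commutes with this closure and with x_j; what remains
     is that c and d commute. *)
  rewrite lj; have [c ck ec] := bc_x AP jk; have [d dk ed] := bc_x BP jk.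
  rewrite ec ed (mor_cj BM) (mor_cj AM) ec ed -!cjM.
  have hc := conj_displ_nclk ck; have hd := gen_displ_nclk dk.
  rewrite -[B c](mulgVK c) -[A d](mulgVK d).
  move: (B c * c^-1) (A d * d^-1) hc hd => p q hp hq.
  have rem r y y' : mixed r -> ncl x k y -> ncl x k y' ->
      cj (r * y * y') (x j) = cj (y * y') (x j).
    move=> hr hy hy'; have e : r * y * y' = y * y' * r.
      rewrite -mulgA; apply: (ncl_comm xP (mixed_nclk hr)); exact: generatedM.
    by rewrite e cjM (ncl_cj_fix (mixed_nclj hr)) //; apply: ncl_x.
  by rewrite !rem // (ncl_comm xP ck dk).
case: (Ax lj lk) => e.
  by apply: conj_comm_fix => //; exists c'.
have h : B (A (cj (x k)^-1 (x l))) = A (B (cj (x k)^-1 (x l))).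
  apply: conj_comm_fix => //; exists (U' (x k)^-1 * c' * x k).
    apply: generatedM (ncl_x _ _); apply: generatedM => //.
    exact/(bc_ncl UP')/generatedV/ncl_x.
  by rewrite (mor_cj (bc_mor UP')) eU /cj; gsimp.
have -> : x l = cj (x k) (cj (x k)^-1 (x l)) by rewrite -cjM mulgV cj1.
rewrite (mor_cj AM) (mor_cj BM) h BAk.
by rewrite [in RHS](mor_cj BM) [in RHS](mor_cj AM).
Qed.

End Generator.
End Homotopy.

(** * Pure braid relations *)

Definition reduce (T : eqType) (w : word T) : word T :=
  foldr (fun a acc => if acc is b :: acc' then
     if (a.1 == b.1) && (a.2 != b.2) then acc' else a :: acc else [:: a]) [::] w.

Lemma ev_reduce (T : eqType) (G : groupType) (f : T -> G) w : ev f (reduce w) = ev f w.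
Proof.
elim: w => [|[a b] w IH] //=; rewrite -IH; case: (reduce w) => [|[a' b'] w'] //=.
case: (a =P a') => [<-|//]; case: b b' => [] [] //=; gsimp => //.
Qed.

(** Free reduction after each letter keeps words short and turns the identity to be checked into a
    syntactic one. *)
Definition rho_reduce n (beta : word ('I_n * 'I_n)) (g : word 'I_n) : word 'I_n :=
  foldl (fun h a => reduce (artin_letter a h)) g beta.

Lemma ev_rho_reduce n (beta : word ('I_n * 'I_n)) g (G : groupType) (x : 'I_n -> G) :
  ev x (rho_reduce beta g) = ev x (rho beta g).
Proof.
(* One letter of the action changes the assignment at which the word is evaluated, so the induction
   needs equality of values in all groups. *)
suff h g' : (forall (H : groupType) (y : 'I_n -> H), ev y g = ev y g') ->
    ev x (rho_reduce beta g) = ev x (rho beta g') by apply: h.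
elim: beta g g' => [|a u IH] g g' e; first exact: e.
by apply: IH => H y; rewrite ev_reduce !ev_letter e.
Qed.

Definition braid_relator n (r s i j : 'I_n) : word ('I_n * 'I_n) :=
  conj_word (gen (i, j)) (gen (r, s)) ++ inv_word (artin_img (fun m => (m, j)) r s i).

Definition ords5 : seq 'I_5 := [:: @Ordinal 5 0 isT; @Ordinal 5 1 isT;
  @Ordinal 5 2 isT; @Ordinal 5 3 isT; @Ordinal 5 4 isT].

Lemma mem_ords5 (i : 'I_5) : i \in ords5.
Proof. by case: i => [[|[|[|[|[|i]]]]] hi]; rewrite // !inE -!val_eqE. Qed.

(* A relator A_ij^(A_rs) = ... and a test generator x_k involve at most five indices, and the
   action depends only on their relative order, so five strands suffice. *)
Lemma braid_relator5 : all (fun r : 'I_5 => all (fun s : 'I_5 => (r < s) ==>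
  all (fun i : 'I_5 => all (fun j : 'I_5 => (s < j) && (i < j) ==>
  all (fun k : 'I_5 => rho_reduce (braid_relator r s i j) (gen k) == (gen k : word 'I_5))
  ords5) ords5) ords5) ords5) ords5.
Proof. by vm_compute. Qed.

Definition wmap T U (f : T -> U) (w : word T) : word U := [seq (f a.1, a.2) | a <- w].

(** * Relabelling strands by an order-preserving map *)

Section Naturality.
Variables (n p : nat) (L : {pred 'I_n}) (f : 'I_n -> 'I_p).
Hypothesis fL : {in L &, forall i j, (f i < f j) = (i < j)}.

Lemma eqfL : {in L &, forall i j, (f i == f j) = (i == j)}.
Proof.
move=> i j iL jL; rewrite -!val_eqE; case: (ltngtP i j) => ij.
- by rewrite ltn_eqF // fL.
- by rewrite gtn_eqF // fL.
- by move/ord_inj: ij => ->; rewrite eqxx.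
Qed.

Definition over T (P : pred T) (w : word T) := all (fun a => P a.1) w.

Lemma over_inv T (P : pred T) (w : word T) : over P (inv_word w) = over P w.
Proof. by rewrite /over /inv_word all_rev all_map. Qed.

Lemma wmap_inv T U (h : T -> U) (w : word T) : wmap h (inv_word w) = inv_word (wmap h w).
Proof. by rewrite /wmap /inv_word map_rev -!map_comp. Qed.

Lemma wmap_artin_img T U (y : 'I_n -> T) (z : 'I_p -> U) (h : T -> U) r s k :
  r \in L -> s \in L -> k \in L -> (forall i, h (y i) = z (f i)) ->
  wmap h (artin_img y r s k) = artin_img z (f r) (f s) (f k).
Proof.
move=> rL sL kL e; rewrite /artin_img !eqfL // (fL rL kL) (fL kL sL).
by do !case: ifP => _; rewrite /wmap /= !e.
Qed.

Lemma wmap_artin_img_inv r s k : r \in L -> s \in L -> k \in L ->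
  wmap f (artin_img_inv id r s k) = artin_img_inv id (f r) (f s) (f k).
Proof.
move=> rL sL kL; rewrite /artin_img_inv !eqfL // (fL rL kL) (fL kL sL).
by do !case: ifP => _.
Qed.

Lemma over_artin_img T (P : pred T) (y : 'I_n -> T) r s k :
  P (y r) -> P (y s) -> P (y k) -> over P (artin_img y r s k).
Proof.
move=> rL sL kL; rewrite /over /artin_img.
by do !case: ifP => _; rewrite /= ?rL ?sL ?kL.
Qed.

Lemma over_artin_img_inv r s k :
  r \in L -> s \in L -> k \in L -> over (mem L) (artin_img_inv id r s k).
Proof.
move=> rL sL kL; rewrite /over /artin_img_inv.
by do !case: ifP => _; rewrite /= ?rL ?sL ?kL.
Qed.

Definition pmap2 (a : 'I_n * 'I_n) : 'I_p * 'I_p := (f a.1, f a.2).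
Definition in2 : pred ('I_n * 'I_n) := fun a => (a.1 \in L) && (a.2 \in L).

Lemma over_subst T U (P : pred T) (Q : pred U) (h : T -> word U) w :
  (forall a, P a -> over Q (h a)) -> over P w -> over Q (subst_word h w).
Proof.
move=> hh; elim: w => [|[a b] w IH] //= /andP[/hh ha hw].
rewrite /subst_word /= /over all_cat; apply/andP; split; last exact: IH.
by case: b; rewrite -/(over _ _) ?over_inv.
Qed.

Lemma wmap_subst T U T' U' (P : pred T) (h : T -> word U) (h' : T' -> word U')
    (d : T -> T') (e : U -> U') w :
  (forall a, P a -> wmap e (h a) = h' (d a)) -> over P w ->
  wmap e (subst_word h w) = subst_word h' (wmap d w).
Proof.
move=> hh; elim: w => [|[a b] w IH] //= /andP[/hh ha hw].
rewrite /subst_word /= /wmap map_cat; congr (_ ++ _); last exact: IH.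
by case: b; rewrite -/(wmap _ _) ?wmap_inv /= ha.
Qed.

Lemma over_letter r s b w : r \in L -> s \in L -> over (mem L) w ->
  over (mem L) (artin_letter (r, s, b) w).
Proof.
move=> rL sL wL; rewrite /artin_letter /=; case: ifP => // _.
apply: over_subst wL => k kL; case: b; first exact: over_artin_img_inv.
exact: over_artin_img.
Qed.

Lemma wmap_letter r s b w : r \in L -> s \in L -> over (mem L) w ->
  wmap f (artin_letter (r, s, b) w) = artin_letter (f r, f s, b) (wmap f w).
Proof.
move=> rL sL wL; rewrite /artin_letter /= fL //; case: ifP => // _.
apply: wmap_subst wL => k kL; case: b; first exact: wmap_artin_img_inv.
exact: wmap_artin_img.
Qed.

Lemma rho_natural u w : over in2 u -> over (mem L) w ->
  over (mem L) (rho u w) /\ wmap f (rho u w) = rho (wmap pmap2 u) (wmap f w).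
Proof.
elim: u w => [|[[r s] b] u IH] w //= /andP[/andP[rL sL] uL] wL.
have [h1 h2] := IH _ uL (over_letter b rL sL wL).
by rewrite h2 wmap_letter.
Qed.

Lemma over_braid_relator r s i j : r \in L -> s \in L -> i \in L -> j \in L ->
  over in2 (braid_relator r s i j).
Proof.
move=> rL sL iL jL; rewrite /over /braid_relator all_cat -!/(over in2 _).
rewrite over_inv over_artin_img; rewrite /in2 /= ?rL ?sL ?iL ?jL //.
Qed.

Lemma wmap_braid_relator r s i j : r \in L -> s \in L -> i \in L -> j \in L ->
  wmap pmap2 (braid_relator r s i j) = braid_relator (f r) (f s) (f i) (f j).
Proof.
move=> rL sL iL jL; rewrite /wmap /braid_relator map_cat -!/(wmap _ _).
by rewrite wmap_inv (wmap_artin_img (z := fun m => (m, f j))).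
Qed.

End Naturality.

Lemma ev_wmap T U (G : groupType) (h : T -> U) (x : U -> G) w :
  ev x (wmap h w) = ev (fun a => x (h a)) w.
Proof. by elim: w => [|a w IH] //=; rewrite IH. Qed.

Lemma count_ltn T (P Q : pred T) (w : seq T) :
  subpred P Q -> has (fun a => Q a && ~~ P a) w -> count P w < count Q w.
Proof.
move=> PQ; elim: w => [|a w IH] //= /orP[/andP[-> /negPf ->]|/IH h].
  by rewrite add0n add1n ltnS sub_count.
by rewrite -addnS leq_add //; case: (P a) (PQ a) => // ->.
Qed.

Lemma rho_braid_relator n (r s i j k : 'I_n) (G : groupType) (x : 'I_n -> G) :
  r < s -> s < j -> i < j -> ev x (rho (braid_relator r s i j) (gen k)) = x k.
Proof.
move=> rs sj ij; pose L := [:: r; s; i; j; k].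
(* The number of entries of [L] below [z]: strictly increasing on [L], and at most 4 because [z]
   itself is an entry that is not counted. The five indices may coincide. *)
pose f (z : 'I_n) : 'I_5 := inord (count (fun y : 'I_n => y < z) L).
have cL z : z \in L -> count (fun y : 'I_n => y < z) L < 5.
  move=> zL; rewrite -[5]/(size L) -count_predT; apply: count_ltn => //.
  by apply/hasP; exists z; rewrite //= ltnn.
have fE z : z \in L -> f z = count (fun y : 'I_n => y < z) L :> nat.
  by move=> zL; apply: inordK; exact: cL.
have mono y z : y \in L -> z \in L -> y < z -> f y < f z.
  move=> yL zL yz; rewrite !fE //.
  apply: count_ltn; first by move=> t /= ty; apply: ltn_trans yz.
  by apply/hasP; exists y; rewrite //= ltnn yz.
have fL : {in mem L &, forall y z : 'I_n, (f y < f z) = (y < z)}.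
  move=> y z yL zL; apply/idP/idP; last exact: mono.
  case: (ltngtP y z) => // [zy|/ord_inj ->]; last by rewrite ltnn.
  by move=> h; have := ltn_trans h (mono _ _ zL yL zy); rewrite ltnn.
have [rL sL iL jL kL] : [/\ r \in L, s \in L, i \in L, j \in L & k \in L].
  by rewrite !inE !eqxx !orbT.
have gL : over (mem L) (gen k) by rewrite /over /= kL.
have [h1 h2] := rho_natural fL (over_braid_relator rL sL iL jL) gL.
(* A left inverse of [f] on [L]; the default [r] is never reached at [f z] with [z] in [L]. *)
pose d (q : 'I_5) := nth r L (find (fun y => f y == q) L).
have fK : {in L, cancel f d}.
  move=> z zL; have hz : has (fun y => f y == f z) L by apply/hasP; exists z.
  have := nth_find r hz; rewrite -/(d (f z)) => /eqP e.
  apply/eqP; rewrite -(eqfL fL) ?e //; apply: mem_nth; by rewrite -has_find.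
have -> : ev x (rho (braid_relator r s i j) (gen k)) =
    ev (fun q => x (d q)) (wmap f (rho (braid_relator r s i j) (gen k))).
  rewrite ev_wmap; elim: (rho _ _) h1 => [|[a b] w IH] //= /andP[aL wL].
  by rewrite (fK a aL) IH.
rewrite h2 (wmap_braid_relator fL) //.
have := braid_relator5 => /allP/(_ _ (mem_ords5 (f r)))/allP/(_ _ (mem_ords5 (f s))).
rewrite fL // rs => /allP/(_ _ (mem_ords5 (f i)))/allP/(_ _ (mem_ords5 (f j))).
rewrite (fL _ _ sL jL) (fL _ _ iL jL) sj ij => /allP/(_ _ (mem_ords5 (f k)))/eqP e.
by rewrite -ev_rho_reduce e ev_gen fK.
Qed.

(** * The Artin action respects the relations of hP_n *)

Section BraidAction.
Variables (n : nat) (G : groupType) (x : 'I_n -> G).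
Hypothesis xP : presents (@RF_rel n) x.
Variable phi : ('I_n * 'I_n) * bool -> G -> G.
Hypothesis phiM : forall a, {morph phi a : y z / y * z}.
Hypothesis phiE : forall a w, phi a (ev x w) = ev x (artin_letter a w).
Implicit Types (i j k l m : 'I_n) (g h y : G) (a : ('I_n * 'I_n) * bool)
  (u v : word ('I_n * 'I_n)).
Local Notation act := (act phi).

Lemma act_inv u : cancel (act u) (act (inv_word u)).
Proof.
elim: u => [|[[r s] b] u IH] g //.
rewrite inv_word_cons act_cat -[act (_ :: u) g]/(act u (phi (r, s, b) g)) IH.
exact: (phiK xP phiM phiE).
Qed.

Lemma act_invV u : cancel (act (inv_word u)) (act u).
Proof. by move=> g; rewrite -{1}(inv_wordK u) act_inv. Qed.

Lemma act_comm u v : (forall g, act v (act u g) = act u (act v g)) ->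
  forall g, act (comm_word u v) g = g.
Proof. by move=> h g; rewrite /comm_word !act_cat h !act_inv. Qed.

Lemma phi_bc m k b : m < k -> basisconj x k (phi (m, k, b)) (letter x m b).
Proof.
move=> mk; have km : (k == m) = false by rewrite -val_eqE gtn_eqF.
split=> // [l lk|]; rewrite (phi_x xP phiE) /conjugator mk /=.
  rewrite (negPf lk); eexists; last by [].
  case: b; case: ifP => _.
  - exact/generatedV/ncl_x.
  - case: ifP => _; last exact: generated1.
    exact/ncl_cml/generatedV/ncl_x.
  - exact: ncl_gen.
  - case: ifP => _; last exact: generated1.
    exact/ncl_cmr/ncl_x.
by rewrite km eqxx; case: b.
Qed.

Definition strand k : pred (('I_n * 'I_n) * bool) :=
  fun a => (a.1.2 == k) && (a.1.1 < k).

Lemma act_bc k u : all (strand k) u ->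
  basisconj x k (act u) (ev (fun p => x p.1) u).
Proof.
elim: u => [|[[r s] b] u IH] /=; first by move=> _; apply: bc_id.
move=> /andP[/andP[/eqP /= -> rk] /IH hu].
have := bc_comp xP (phi_bc b rk) hu.
by rewrite /letter; case: b.
Qed.

Lemma strand_inv k u : all (strand k) (inv_word u) = all (strand k) u.
Proof. by rewrite /inv_word all_rev all_map. Qed.

Lemma act_homotopy j k u : j < k -> all (strand k) u ->
  forall g, act (comm_word (gen (j, k)) (conj_word (gen (j, k)) u)) g = g.
Proof.
move=> jk hu; apply: act_comm => g; rewrite /conj_word !act_cat.
have hu' : all (strand k) (inv_word u) by rewrite strand_inv.
have nkj : j != k by rewrite -val_eqE ltn_eqF.
have UP' := act_bc hu'; rewrite ev_inv in UP'.
apply: (conj_comm xP nkj (phi_bc false jk) (act_bc hu) UP' (act_invV u)).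
move=> l lj lk; rewrite (mor_cj (phiM _)) !(phi_x xP phiE) /conjugator /= jk.
rewrite (negPf lj) (negPf lk) (morV (phiM _)).
(* For l between j and k, A_jk conjugates x_l by [x_j, x_k] and sends x_k^-1 to x_j x_k^-1 x_j^-1;
   the product of the two is x_k^-1. *)
case: ifP => _; [right | by left; rewrite cj1].
rewrite (phi_x xP phiE) /conjugator /= jk eq_sym (negPf nkj) eqxx.
by rewrite /cj /cm; gsimp.
Qed.

Lemma act_rel r : hP_rel r -> forall g, act r g = g.
Proof.
case=> [[[i [j [ij ->]]]|[r' [s [i [j [rs sj ij ->]]]]]]|[j [k [jk [u [hu ->]]]]]].
- move=> g; have [w <-] := pres_surj xP g.
  by rewrite (actE phiE) /= /artin_letter /= (negPf ij).
- apply: (mor_ext xP (f' := id)) => [|//|k]; first exact: actM.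
  rewrite -[X in act _ X](ev_gen x) (actE phiE).
  exact: rho_braid_relator.
- exact: act_homotopy.
Qed.

Lemma act_pres u v : pres_eq (@hP_rel n) u v -> act u =1 act v.
Proof.
elim=> {u v} [u|u v _ IH|u v w _ IH1 _ IH2|u v [r s] b|u v r /act_rel hr] g //.
- by rewrite IH1 IH2.
- rewrite !act_cat -[LHS]/(act v (phi (r, s, ~~ b) (phi (r, s, b) (act u g)))).
  by rewrite (phiK xP phiM phiE).
- by rewrite !act_cat hr.
Qed.

End BraidAction.

(** * Combing *)

Section Key.
Variables (n : nat) (G : groupType) (x : 'I_n -> G).
Hypothesis xP : presents (@RF_rel n) x.

(* Compare the coefficients of s X_m in w x_m and x_m w. *)
Lemma lcsg_of_comm j m (w : word 'I_n) : 0 < j -> (forall b, (m, b) \notin w) ->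
  lcsg j.+1 (cm (ev x w) (x m)) -> lcsg j (ev x w).
Proof.
move=> j0 wm; rewrite -[x m](ev_gen x) -ev_comm -(lcs_lcsg xP) => /(lcs_agree (ltn0Sn j)).
move=> /agree_comm h; apply: (agree_lcsg xP) => // s us sj.
case: (boolP (m \in s)) => ms.
  by rewrite (mu_notin wm ms); case: (s) ms.
case: s us sj ms => [|c s] us sj ms; first by rewrite !mu_nil.
have := h (rcons (c :: s) m); rewrite rcons_uniq ms us size_rcons ltnS => /(_ isT sj).
rewrite mu_rcons eqxx [RHS]/=; move: ms; rewrite inE negb_or eq_sym => /andP[/negPf -> _].
rewrite [RHS]GRing.addr0 -[RHS]GRing.addr0 => /GRing.addrI.
by rewrite GRing.mul1r.
Qed.

End Key.

Section Braid.
Variables (n : nat) (G : groupType) (x : 'I_n -> G).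
Hypothesis xP : presents (@RF_rel n) x.
Variables (H : groupType) (y : 'I_n * 'I_n -> H).
Hypothesis yP : presents (@hP_rel n) y.
Implicit Types (i j k l m r s : 'I_n) (u v : word ('I_n * 'I_n)).

Lemma y_triv i j : ~~ (i < j) -> y (i, j) = 1.
Proof.
move=> ij; rewrite -(ev_gen y); apply: (pres_rel yP).
by left; left; exists i, j.
Qed.

Lemma y_conj r s k i : r < s -> s < k ->
  cj (y (r, s))^-1 (y (i, k)) = ev (fun m => y (m, k)) (letter_img (r, s, false) i).
Proof.
move=> rs sk; rewrite /letter_img /= rs; case: (ltnP i k) => ik.
  have /(pres_rel yP) : hP_rel (braid_relator r s i k).
    by left; right; exists r, s, i, k.
  rewrite /braid_relator ev_cat ev_inv ev_conj !ev_gen => /divg1_eq ->.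
  rewrite /artin_img; case: ifP => // _; case: ifP => // _; by case: ifP.
have si := leq_trans sk ik; have ri := ltn_trans rs si.
rewrite /artin_img -!val_eqE !gtn_eqF //= (leq_gtF (ltnW si)) andbF ev_gen.
by rewrite (@y_triv i k) -?leqNgt // (mor1 (cj_mor _)).
Qed.

Definition strand_sub k := generated (fun h => exists i : 'I_n, h = y (i, k)).

Lemma strand_sub_ev k (w : word 'I_n) : strand_sub k (ev (fun m => y (m, k)) w).
Proof.
elim: w => [|[i b] w IH] /=; first exact: generated1.
apply: generatedM => //; have : strand_sub k (y (i, k)) by apply: generated_base; exists i.
by case: b => // /generatedV.
Qed.

Lemma strand_sub_cj k r s b h : s < k -> strand_sub k h ->
  strand_sub k (cj (if b then y (r, s) else (y (r, s))^-1) h).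
Proof.
move=> sk; apply: generated_mor; first exact: cj_mor.
move=> _ [i ->]; case: (ltnP r s) => rs; last first.
  by rewrite (@y_triv r s) -?leqNgt // invg1 if_same cj1; apply: generated_base; exists i.
case: b; last by rewrite y_conj //; apply: strand_sub_ev.
(* The presentation only describes conjugation in one direction. The other is obtained by applying
   it to the image under the inverse letter and cancelling with [letter_imgK]. *)
have -> : y (i, k) = cj (y (r, s))^-1 (ev (fun m => y (m, k)) (letter_img (r, s, true) i)).
  rewrite (ev_mor _ _ (cj_mor _)).
  rewrite (eq_ev (g := fun m => ev (fun m => y (m, k)) (letter_img (r, s, false) m))).
    by rewrite (letter_imgK _ r s false).
  by move=> m; apply: y_conj.
by rewrite -cjM mulgV cj1; apply: strand_sub_ev.
Qed.

Lemma strand_sub_word k h : strand_sub k h ->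
  exists2 t, all (strand k) t & ev y t = h.
Proof.
elim=> {h} [_ [i ->]||h _ [t tk <-]|h h' _ [t tk <-] _ [t' tk' <-]].
- case: (ltnP i k) => ik.
    by exists (gen (i, k)); rewrite ?ev_gen //= /strand eqxx ik.
  by exists [::]; rewrite ?y_triv // -leqNgt.
- by exists [::].
- by exists (inv_word t); rewrite ?strand_inv // ev_inv.
- by exists (t ++ t'); rewrite ?all_cat ?tk // ev_cat.
Qed.

Definition below (m : nat) : pred (('I_n * 'I_n) * bool) := fun a => a.1.2 < m.

Lemma strand_sub_below k v h : all (below k) v -> strand_sub k h ->
  strand_sub k (cj (ev y v)^-1 h).
Proof.
elim: v h => [|[[r s] b] v IH] h /=; first by rewrite invg1 cj1.
move=> /andP[sk /IH hv] hh; rewrite invgM cjM; apply: hv.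
by have := strand_sub_cj r b sk hh; case: (b); rewrite ?invgK.
Qed.

Lemma comb k u : all (below k.+1) u -> exists v t,
  [/\ all (below k) v, all (strand k) t & ev y u = ev y v * ev y t].
Proof.
suff h : all (below k.+1) u -> exists v h,
    [/\ all (below k) v, strand_sub k h & ev y u = ev y v * h].
  by move=> /h[v [h' [hv /strand_sub_word[t ht <-] e]]]; exists v, t.
elim: u => [|[[r s] b] u IH] /=.
  by exists [::], 1; rewrite mulg1; split=> //; apply: generated1.
rewrite {1}/below /= ltnS leq_eqVlt => /andP[sk /IH[v [h [hv hh ->]]]].
case/orP: sk => [/eqP/ord_inj ->|sk]; last first.
  by exists ((r, s, b) :: v), h; rewrite /= {1}/below /= sk mulgA.
set a := (if b then _ else _).
have ha : strand_sub k a.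
  have : strand_sub k (y (r, k)) by apply: generated_base; exists r.
  by rewrite /a; case: (b) => // /generatedV.
(* From a v h = v (v^-1 a v) h, where v^-1 a v stays in the subgroup of strand k because v is below
   it. *)
exists v, (cj (ev y v)^-1 a * h); split=> //; last by rewrite /cj; gsimp.
by apply: generatedM => //; apply: strand_sub_below.
Qed.

Lemma exists_strand_mor k : exists2 f : G -> H, {morph f : g h / g * h} &
  forall w, f (ev x w) = ev (fun m => y (m, k)) w.
Proof.
apply: (pres_lift xP) => _ [i [u ->]]; rewrite ev_comm ev_conj ev_gen.
case: (ltnP i k) => ik; last first.
  by rewrite (@y_triv i k) -?leqNgt // (mor1 (cj_mor _)) /cm; gsimp.
(* The word [u] may contain letters x_m with m >= k, whose images are trivial; the homotopy relator
   wants a word in the A_mk with m < k. *)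
have [t tk et] := strand_sub_word (strand_sub_ev k u).
have /(pres_rel yP) : hP_rel (comm_word (gen (i, k)) (conj_word (gen (i, k)) t)).
  by right; exists i, k; split=> //; exists t.
by rewrite ev_comm ev_conj ev_gen et.
Qed.

Variable phi : ('I_n * 'I_n) * bool -> G -> G.
Hypothesis phiM : forall a, {morph phi a : g h / g * h}.
Hypothesis phiE : forall a w, phi a (ev x w) = ev x (artin_letter a w).
Local Notation act := (act phi).

Lemma exists_act : exists F : H -> G -> G, [/\ forall u g, F (ev y u) g = act u g,
  forall b, {morph F b : g h / g * h},
  forall a b g, F (a * b) g = F b (F a g) & forall g, F 1 g = g].
Proof.
have [s hs] := choice (pres_surj yP).
have e u g : act (s (ev y u)) g = act u g.
  by apply: (act_pres xP phiM phiE); apply/(pres_evP yP).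
exists (fun b => act (s b)); split=> // [b|a b g|g].
- exact: actM.
- by rewrite -(hs a) -(hs b) -ev_cat !e act_cat.
- by rewrite -[1]/(ev y [::]) e.
Qed.

(** Every letter sends each generator to a conjugate, hence acts trivially on the abelianization. *)
Lemma andreadakis1_act u : andreadakis 1 (act u).
Proof.
apply: andreadakis1; first exact: actM.
have hphi a g : lcsg 2 (phi a g * g^-1).
  apply: (generated_displ (P := fun g => exists k, g = x k)) => //.
  - by move=> h z; apply: (@lcsg_cj G 2).
  - move=> _ [k ->]; rewrite (phi_x xP phiE); exact: (@lcsg_cm G 1).
  apply: (gen_ind xP) => [|g' h|g'|k]; [exact: generated1|exact: generatedM|exact: generatedV|].
  by apply: generated_base; exists k.
elim: u => [|a u IH] g; first by rewrite mulgV; apply: lcsg_1.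
have -> : act (a :: u) g * g^-1 = act u (phi a g) * (phi a g)^-1 * (phi a g * g^-1).
  by gsimp.
exact: lcsgM.
Qed.

Lemma andreadakisE (j : nat) u : in_Andreadakis j u <-> andreadakis j (act u).
Proof.
split=> h i g i0 hg.
  have [w ew] := pres_surj xP g; rewrite -ew (actE phiE) -ev_inv -ev_cat -(lcs_lcsg xP).
  by apply: h => //; apply/(lcs_lcsg xP); rewrite ew.
apply/(lcs_lcsg xP); rewrite ev_cat ev_inv -(actE phiE).
by apply: h => //; apply/(lcs_lcsg xP).
Qed.

Lemma act_below k u : all (below k) u -> act u (x k) = x k.
Proof.
elim: u => [|[[r s] b] u IH] //= /andP[sk /IH e]; rewrite /below /= in sk.
rewrite -[LHS]/(act u (phi (r, s, b) (x k))) (phi_x xP phiE) -[RHS]e; congr (act u _).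
rewrite /conjugator /=; case: (ltnP r s) => rs; last by rewrite cj1.
have rk := ltn_trans rs sk.
by rewrite -!val_eqE !gtn_eqF //= (leq_gtF (ltnW sk)) andbF if_same cj1.
Qed.

Lemma andreadakis_lcsg (j : nat) u : 0 < j -> andreadakis j (act u) <-> lcsg j (ev y u).
Proof.
move=> j0; have [F [FE FM Fmul F1]] := exists_act.
have dir v : lcsg j (ev y v) -> andreadakis j (act v).
  move=> hv i g i0 hg; rewrite -FE; apply: (lcsg_andreadakis FM Fmul F1) => // b i' g' i0' hg'.
  by have [b' <-] := pres_surj yP b; rewrite FE; apply: andreadakis1_act.
split=> [|/dir //].
suff h : forall (p : nat) u', p <= n -> all (below p) u' -> andreadakis j (act u') ->
    lcsg j (ev y u').
  move=> hA; have uP : all (below n) u by apply/allP => a _; apply: ltn_ord.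
  exact: (h n u (leqnn n) uP hA).
elim=> [|m IH] {}u; first by case: u => // _ _ _; apply: lcsg_1.
move=> mn hu; pose k := Ordinal mn; have [v [t [hv ht e]]] := comb (k := k) hu.
have ea g : act u g = act (v ++ t) g by rewrite -!FE e ev_cat.
move=> hA; pose w := [seq (a.1.1, a.2) | a <- t] : word 'I_n.
have ew : ev x w = ev (fun p => x p.1) t by rewrite /w; elim: (t) => //= a t' ->.
have ewy : ev (fun m => y (m, k)) w = ev y t.
  rewrite /w; elim: (t) ht => //= -[[r s] b] t' IHt /andP[/andP[/eqP /= -> _] /IHt ->].
  by [].
have ht' : lcsg j (ev y t).
  have [f fM fE] := exists_strand_mor k; rewrite -ewy -fE; apply: (lcsg_mor fM).
  apply: (lcsg_of_comm xP j0 (m := k)).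
    move=> b; apply/negP => /mapP[[[r s] b']] /(allP ht) /andP[_ /= rk] [kr _].
    by rewrite -kr ltnn in rk.
  (* The displacement of x_k is w x_k w^-1 x_k^-1, which is convertible to [cm]. *)
  have := hA 1%N (x k) isT I; rewrite add1n ea act_cat (act_below hv).
  by rewrite (bc_k (act_bc xP phiM phiE ht)) ew.
rewrite e; apply: lcsgM => //; apply: (IH v (ltnW mn)) => // i g i0 hg.
have -> : act v g = F (ev y u * (ev y t)^-1) g by rewrite e mulgK FE.
apply: (andreadakis_mul FM Fmul (j := j)) i0 hg.
  by move=> i' g' i0' hg'; rewrite FE; apply: hA.
apply: (andreadakis_inv FM Fmul F1) => i' g' i0' hg'; rewrite FE; exact: dir.
Qed.

End Braid.

Local Close Scope group_scope.

Theorem theorem4p13 (n : nat) (hn : 1 <= n) (j : nat) (hj : 1 <= j)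
    (beta : word ('I_n * 'I_n)) :
  @Gamma_hP n j beta <-> @in_Andreadakis n j beta.
Proof.
have [G [x xP]] := presentation (@RF_rel n).
have [H [y yP]] := presentation (@hP_rel n).
have [phi phiP] := exists_letter_act xP.
have phiM a := (phiP a).1; have phiE a := (phiP a).2.
rewrite /Gamma_hP (lcs_lcsg yP) (andreadakisE xP phiE).
by rewrite (andreadakis_lcsg xP yP phiM phiE _ hj).
Qed.
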